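(* Let $(X,d)$ and $(Y,d)$ be two complete Gromov hyperbolic geodesic spaces, and suppose that there exists a $\tau$-rough isometry $\Phi:Y\to X$. Let $y_0\in Y$ and set $x_0=\Phi(y_0)$. Let $\varepsilon>0$, let $(X_\varepsilon,d_\varepsilon)$ be the uniformization of $X$ with parameter $\varepsilon$ and base point $x_0$, and let $(Y_\varepsilon,d_\varepsilon)$ be the uniformization of $Y$ with parameter $\varepsilon$ and base point $y_0$. If $(X_\varepsilon,d_\varepsilon)$ is a uniform domain with a uniformity constant $\lambda$, then $(Y_\varepsilon,d_\varepsilon)$ is also a uniform domain, with a uniformity constant that depends solely on $\lambda$, $\varepsilon$, and $\tau$.
   Context: Gromov hyperbolic: a complete, unbounded, locally compact, geodesic metric space $(Z,d)$ is Gromov hyperbolic if there is $\delta\ge 0$ such that for all $x,y,z\in Z$ and all geodesic paths $[x,y],[y,z],[z,x]$ joining them, every point of $[x,y]$ lies within distance $\le\delta$ of some point of $[y,z]\cup[z,x]$. (The metrics on $X$ and $Y$ are both denoted $d$.) Rough isometry: for $\tau\ge 0$, a map $\Phi:Y\to X$ (not necessarily continuous, injective or surjective) is a $\tau$-rough isometry if $d(y_1,y_2)-\tau\le d(\Phi(y_1),\Phi(y_2))\le d(y_1,y_2)+\tau$ for all $y_1,y_2\in Y$, and for each $x\in X$ there is $y\in Y$ with $d(x,\Phi(y))\le\tau$. Uniformization: for a Gromov hyperbolic space $(Z,d)$, base point $z_0\in Z$ and $\varepsilon>0$, let $\rho_\varepsilon^Z(z)=e^{-\varepsilon d(z,z_0)}$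 and $d_\varepsilon(z_1,z_2)=\inf_\gamma\int_\gamma\rho_\varepsilon^Z\,ds$, the infimum over all rectifiable paths $\gamma$ in $Z$ with end points $z_1,z_2$, and $ds$ being arc-length measure with respect to $d$. The metric space $(Z,d_\varepsilon)$ is denoted $Z_\varepsilon$. Uniform domain: let $(Z,d)$ be a locally complete (every point has a complete neighborhood), non-complete metric space, and $\partial Z:=\overline Z\setminus Z$, where $\overline Z$ is the metric completion. $Z$ is a uniform domain with uniformity constant $\lambda\ge1$ if each pair $x,y\in Z$ can be joined by a rectifiable curve $\gamma$ in $Z$ such that (1) $\ell(\gamma)\le\lambda d(x,y)$, and (2) for each $z\in\gamma$, $\operatorname{dist}(z,\partial Z)\ge\lambda^{-1}\min\{\ell(\gamma(x,z)),\ell(\gamma(z,y))\}$, where $\gamma(x,z)$ and $\gamma(z,y)$ denote subcurves of $\gamma$ with the indicated end points. Here $\ell$ denotes length with respect to the metric of the space considered (so for $Z_\varepsilon$ all notions are with respect to $d_\varepsilon$). *)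

(* Defs.v *)
From HB Require Import structures.
From mathcomp Require Import all_boot all_order all_algebra.
From mathcomp Require Import all_classical all_reals all_analysis.
Set Implicit Arguments.
Unset Strict Implicit.
Unset Printing Implicit Defensive.
Import Order.TTheory GRing.Theory Num.Theory.
Import numFieldNormedType.Exports.
Local Open Scope classical_set_scope.
Local Open Scope ring_scope.

Section curves.
Context {R : realType} {T : metricType R}.
Implicit Types (g : R -> T) (a b : R) (x y : T).

(* The curve is the restriction of [g] to the interval [a, b]. For [a <= b],
   an [itv_partition a b s] is a list [s] with a < s_0 < ... < s_last = b. *)
Definition curve_length g a b : \bar R :=
  ereal_sup [set (\sum_(i < size s)
    mdist (g (nth b (a :: s) i)) (g (nth b s i)))%:E | s in itv_partition a b].

Definition rectifiable_path g a b x y : Prop :=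
  [/\ a <= b, {within `[a, b], continuous g}, g a = x, g b = y &
      (curve_length g a b < +oo)%E].

(* The point g(t), where [t] is the first time in [a, b] at which the length
   run through equals [s]. *)
Definition arclength_param g a b (s : R) : T :=
  g (inf [set t | t \in `[a, b] /\ curve_length g a t = s%:E]).

Definition path_integral (rho : T -> R) g a b : R :=
  \int[lebesgue_measure]_(s in `[0, fine (curve_length g a b)])
    rho (arclength_param g a b s).

Definition geodesic_path g x y : Prop :=
  [/\ g 0 = x, g (mdist x y) = y &
      {in `[0, mdist x y] &, forall s t, mdist (g s) (g t) = `|s - t|}].

End curves.

Section metric_notions.
Context {R : realType}.
Implicit Type T : metricType R.

Definition complete_subset T (N : set T) : Prop :=
  forall u : nat -> T, (forall n, N (u n)) -> cauchy (u @ \oo) ->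
    exists2 x, N x & u @ \oo --> x.

Definition complete_space T : Prop := complete_subset [set: T].

Definition locally_complete T : Prop :=
  forall z : T, exists2 N : set T, nbhs z N & complete_subset N.

Definition unbounded_space T : Prop :=
  forall M : R, exists x y : T, M < mdist x y.

Definition geodesic_space T : Prop :=
  forall x y : T, exists g, geodesic_path g x y.

Definition thin_triangles T (delta : R) : Prop :=
  forall (x y z : T) (gxy gyz gzx : R -> T),
    geodesic_path gxy x y -> geodesic_path gyz y z -> geodesic_path gzx z x ->
    forall p, (gxy @` `[0, mdist x y]) p ->
      exists2 q, (gyz @` `[0, mdist y z] `|` gzx @` `[0, mdist z x]) q &
                 mdist p q <= delta.

Definition gromov_hyperbolic T : Prop :=
  [/\ complete_space T, unbounded_space T, locally_compact [set: T],
      geodesic_space T &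
      exists2 delta : R, 0 <= delta & thin_triangles T delta].

Definition rough_isometry (Y X : metricType R) (tau : R) (Phi : Y -> X) : Prop :=
  (forall y1 y2 : Y, mdist y1 y2 - tau <= mdist (Phi y1) (Phi y2)
                                       <= mdist y1 y2 + tau) /\
  (forall x : X, exists y : Y, mdist x (Phi y) <= tau).

End metric_notions.

(* Metric completion: Cauchy sequences modulo lim d(u_n, v_n) = 0. *)
Section completion.
Context {R : realType} (T : metricType R).

Record cauchy_sequence := CauchySequence {
  cauchy_seq :> nat -> T;
  cauchy_seqP : cauchy (cauchy_seq @ \oo) }.

HB.instance Definition _ := gen_eqMixin cauchy_sequence.
HB.instance Definition _ := gen_choiceMixin cauchy_sequence.

Implicit Types u v w : cauchy_sequence.

Definition cauchy_dist u v : R := limn (fun n => mdist (u n) (v n)).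

Lemma cauchy_seq_dist u (e : R) : 0 < e ->
  \forall m & n \near \oo, mdist (u m) (u n) < e.
Proof.
move=> e0.
have /cauchy_ballP/(_ _ e0) := cauchy_seqP u.
by rewrite near_map2; apply: filterS => -[m n] /=; rewrite ballEmdist.
Qed.

Lemma mdist_diff_le (x y x' y' : T) :
  `|mdist x y - mdist x' y'| <= mdist x x' + mdist y y'.
Proof.
have h (a b a' b' : T) : mdist a b <= mdist a' b' + (mdist a a' + mdist b b').
  apply: (le_trans (metric_triangle a a' b)).
  rewrite addrCA lerD2l.
  by rewrite (metric_sym b b') metric_triangle.
rewrite ler_norml; apply/andP; split.
  by rewrite lerNl opprB lerBlDl (metric_sym x x') (metric_sym y y') h.
by rewrite lerBlDl h.
Qed.

Lemma is_cvg_cauchy_dist u v : cvgn (fun n => mdist (u n) (v n)).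
Proof.
apply/cauchy_cvgP; apply/cauchy_ballP => e e0; near_simpl.
have e20 : 0 < e / 2 by rewrite divr_gt0.
apply: filterS2 (cauchy_seq_dist u e20) (cauchy_seq_dist v e20) => -[m n] /= um vm.
rewrite /ball /=; apply: (le_lt_trans (mdist_diff_le _ _ _ _)).
by rewrite [ltRHS]splitr ltrD.
Qed.

Lemma cauchy_distxx u : cauchy_dist u u = 0.
Proof.
rewrite /cauchy_dist (_ : (fun _ => _) = cst 0) ?lim_cst//.
by apply/funext => n; rewrite mdistxx.
Qed.

Lemma cauchy_dist_sym u v : cauchy_dist u v = cauchy_dist v u.
Proof.
by rewrite /cauchy_dist; congr (lim (_ @ \oo)); apply/funext => n; rewrite metric_sym.
Qed.

Lemma cauchy_dist_triangle v u w :
  cauchy_dist u w <= cauchy_dist u v + cauchy_dist v w.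
Proof.
rewrite /cauchy_dist -limD; [|exact: is_cvg_cauchy_dist..].
apply: ler_lim; [exact: is_cvg_cauchy_dist|
  by apply: is_cvgD; exact: is_cvg_cauchy_dist|].
by apply: nearW => n; exact: metric_triangle.
Qed.

Lemma cauchy_dist_ge0 u v : 0 <= cauchy_dist u v.
Proof.
apply: limr_ge; first exact: is_cvg_cauchy_dist.
by apply: nearW => n; exact: mdist_ge0.
Qed.

Definition cauchy_equiv u v : bool := cauchy_dist u v == 0.

Lemma cauchy_equiv_refl : reflexive cauchy_equiv.
Proof. by move=> u; rewrite /cauchy_equiv cauchy_distxx. Qed.

Lemma cauchy_equiv_sym : symmetric cauchy_equiv.
Proof. by move=> u v; rewrite /cauchy_equiv cauchy_dist_sym. Qed.

Lemma cauchy_equiv_trans : transitive cauchy_equiv.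
Proof.
move=> v u w /eqP uv /eqP vw; rewrite /cauchy_equiv eq_le cauchy_dist_ge0 andbT.
by rewrite (le_trans (cauchy_dist_triangle v u w))// uv vw addr0.
Qed.

Canonical cauchy_equiv_rel :=
  EquivRel cauchy_equiv cauchy_equiv_refl cauchy_equiv_sym cauchy_equiv_trans.

Definition completion := {eq_quot cauchy_equiv}%qT.

HB.instance Definition _ := Choice.on completion.

Definition completion_dist (p q : completion) : R :=
  cauchy_dist (repr p) (repr q).

Lemma completion_distxx p : completion_dist p p = 0.
Proof. exact: cauchy_distxx. Qed.

Lemma completion_dist_eq0 p q : completion_dist p q = 0 -> p = q.
Proof.
by move=> /eqP pq; rewrite -[p]reprK -[q]reprK; apply/eqP; rewrite eqmodE.
Qed.

Lemma completion_dist_sym p q : completion_dist p q = completion_dist q p.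
Proof. exact: cauchy_dist_sym. Qed.

Lemma completion_dist_triangle q p r :
  completion_dist p r <= completion_dist p q + completion_dist q r.
Proof. exact: cauchy_dist_triangle. Qed.

HB.instance Definition _ := isMetric.Build R completion completion_distxx
  completion_dist_eq0 completion_dist_sym completion_dist_triangle.

Lemma cauchy_cst (z : T) : cauchy ((fun _ : nat => z) @ \oo).
Proof.
apply/cauchy_ballP => e e0; near_simpl.
apply: (filterS _ filterT) => x _ /=; exact: ball_center (PosNum e0).
Qed.

Definition to_completion (z : T) : completion :=
  \pi_completion%qT (CauchySequence (cauchy_cst z)).

Definition boundary : set completion := ~` range to_completion.

Definition boundary_dist (z : T) : R :=
  inf [set mdist (to_completion z) p | p in boundary].

End completion.

Section uniform_domain.
Context {R : realType}.

Definition uniform_domain (Z : metricType R) (lambda : R) : Prop :=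
  [/\ locally_complete Z, ~ complete_space Z, 1 <= lambda &
    forall x y : Z, exists (g : R -> Z) (a b : R),
      [/\ rectifiable_path g a b x y,
          (curve_length g a b <= (lambda * mdist x y)%:E)%E &
          forall t, t \in `[a, b] ->
            (lambda^-1%:E * Order.min (curve_length g a t) (curve_length g t b)
             <= (boundary_dist (g t))%:E)%E]].

End uniform_domain.

(* A type together with an arbitrary distance function, as a metric space. *)
Section metric_of.
Context {R : realType} (T : choiceType).

Record is_distance (d : T -> T -> R) : Prop := IsDistance {
  is_distancexx : forall x, d x x = 0;
  is_distance_eq0 : forall x y, d x y = 0 -> x = y;
  is_distance_sym : forall x y, d x y = d y x;
  is_distance_triangle : forall y x z, d x z <= d x y + d y z }.

Definition metric_of (d : T -> T -> R) (dP : is_distance d) : Type := T.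

Context (d : T -> T -> R) (dP : is_distance d).

HB.instance Definition _ := Choice.on (metric_of dP).
HB.instance Definition _ := isMetric.Build R (metric_of dP)
  (is_distancexx dP) (is_distance_eq0 dP) (is_distance_sym dP)
  (is_distance_triangle dP).

End metric_of.

Section uniformization.
Context {R : realType} {Z : metricType R}.

Definition rho_eps (z0 : Z) (eps : R) (z : Z) : R := expR (- eps * mdist z z0).

Definition d_eps (z0 : Z) (eps : R) (z1 z2 : Z) : R :=
  inf [set r | exists (g : R -> Z) (a b : R),
    rectifiable_path g a b z1 z2 /\ r = path_integral (rho_eps z0 eps) g a b].

(* The metric axioms for [d_eps] are part of the predicate; they always hold
   when [Z] is geodesic. *)
Definition uniformization_is_uniform (z0 : Z) (eps lambda : R) : Prop :=
  exists dP : is_distance (d_eps z0 eps), uniform_domain (metric_of dP) lambda.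

End uniformization.

(* Main.v *)
Require Import Defs.
From mathcomp Require Import all_boot all_order all_algebra.
From mathcomp Require Import all_classical all_reals all_analysis.
From mathcomp Require Import ring lra.
Import Order.TTheory GRing.Theory Num.Theory.
Import numFieldNormedType.Exports.
Local Open Scope classical_set_scope.
Local Open Scope ring_scope.

(** For a geodesic space, with [rho = rho_eps], two estimates control [d_eps]:
    [exp(-eps) rho(x) min(1, d(x,y)) <= d_eps(x,y) <= exp(eps d(x,y)) rho(x) d(x,y)].
    They show that [d_eps] is a distance and, for a complete space, that a
    [d_eps]-Cauchy sequence diverges exactly when its weights [rho] tend to [0].
    Sampling a nearly optimal path at unit steps, [d_eps(Phi y, Phi y') <= C d_eps(y, y')]
    as soon as [d(y,y') >= 1]; hence [Phi] carries boundary points to boundary points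
    and [dist(p, bd X_eps) <= C dist(z, bd Y_eps)] when [p] is near [Phi z].
    Points [y], [y'] at bounded distance are joined by a geodesic.  Otherwise a
    uniform curve from [Phi y] to [Phi y'] is cut into steps of [d_eps]-length
    comparable to the weight, the division points are moved to [Y] by a rough
    inverse of [Phi], and consecutive images are joined by geodesics; each new
    piece has length comparable to the old one, and the only piece without a
    counterpart (the last one) is dominated by its predecessor. *)

(** * Length of curves *)

Section within_continuity.
Context {R : realType} {T : metricType R}.
Implicit Types (g : R -> T) (a b : R).

Lemma within_continuous_mdistP g a b :
  {within `[a, b], continuous g} <->
  (forall t, t \in `[a, b] -> forall e, 0 < e -> exists2 r, 0 < r &
     forall s, s \in `[a, b] -> `|t - s| < r -> mdist (g t) (g s) < e).
Proof.
rewrite subspace_continuousP; split => [cg t tab e e0|h t tab].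
  have /metricType_numDomainType.cvgrPdist_lt/(_ _ e0) := cg t tab.
  rewrite near_withinE => /nbhs_ballP[r /= r0 hr].
  by exists r => // s sab ts; exact: hr.
apply/metricType_numDomainType.cvgrPdist_lt => e e0; rewrite near_withinE.
have [r r0 hr] := h t tab e e0.
by apply/nbhs_ballP; exists r => //= s ts sab; exact: hr.
Qed.

End within_continuity.

Section curve_length_theory.
Context {R : realType} {T : metricType R}.
Implicit Types (g : R -> T) (a b c t x : R) (s : seq R).

(** Recursive form of the indexed sum in [curve_length], so that partitions can be treated by
    induction on the list. *)
Fixpoint polygon_length g a s : R :=
  if s is x :: s' then mdist (g a) (g x) + polygon_length g x s' else 0.

Lemma polygon_length_ge0 g a s : 0 <= polygon_length g a s.
Proof. by elim: s a => //= x s IH a; rewrite addr_ge0// mdist_ge0. Qed.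

Lemma polygon_length_cat g a s1 s2 :
  polygon_length g a (s1 ++ s2) =
  polygon_length g a s1 + polygon_length g (last a s1) s2.
Proof. by elim: s1 a => /= [|x s IH] a; rewrite ?add0r// IH addrA. Qed.

Lemma curve_lengthE g a b : curve_length g a b =
  ereal_sup [set (polygon_length g a s)%:E | s in itv_partition a b].
Proof.
rewrite /curve_length; congr ereal_sup; apply: eq_imagel => s _; congr EFin.
elim: s a => [|x s IH] a /=; first by rewrite big_ord0.
by rewrite big_ord_recl/= -IH.
Qed.

Lemma polygon_length_le g a b s :
  itv_partition a b s -> ((polygon_length g a s)%:E <= curve_length g a b)%E.
Proof. by move=> abs; rewrite curve_lengthE; apply: ereal_sup_ubound; exists s. Qed.

Lemma curve_length_le g a b (y : \bar R) :
  (forall s, itv_partition a b s -> ((polygon_length g a s)%:E <= y)%E) ->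
  (curve_length g a b <= y)%E.
Proof.
by move=> h; rewrite curve_lengthE; apply: ge_ereal_sup => _ [s abs <-]; exact: h.
Qed.

Lemma itv_partition_trivial a b : a <= b -> exists s, itv_partition a b s.
Proof.
rewrite le_eqVlt => /predU1P[->|ab]; last by exists [:: b]; exact: itv_partition1.
by exists [::]; split => /=.
Qed.

Lemma curve_length_ge0 g a b : a <= b -> (0 <= curve_length g a b)%E.
Proof.
move=> /itv_partition_trivial[s abs]; apply: le_trans (polygon_length_le g _ _ _ abs).
by rewrite lee_fin polygon_length_ge0.
Qed.

Lemma curve_lengthxx g a : curve_length g a a = 0.
Proof.
apply/eqP; rewrite eq_le curve_length_ge0// andbT; apply: curve_length_le => s.
by move=> /itv_partitionxx ->.
Qed.

Lemma mdist_le_curve_length g a b : a <= b ->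
  ((mdist (g a) (g b))%:E <= curve_length g a b)%E.
Proof.
rewrite le_eqVlt => /predU1P[->|ab]; first by rewrite mdistxx curve_length_ge0.
by have := polygon_length_le g _ _ _ (itv_partition1 ab); rewrite /= addr0.
Qed.

(** Partitions of the two pieces concatenate. Once an infinite total is set aside, the two suprema
    are taken one after the other. *)
Lemma curve_length_superadd g a b c : a <= b -> b <= c ->
  (curve_length g a b + curve_length g b c <= curve_length g a c)%E.
Proof.
move=> ab bc; case E : (curve_length g a c) => [r| |]; last 2 first.
- by rewrite leey.
- by have := curve_length_ge0 g _ _ (le_trans ab bc); rewrite E.
have H s1 s2 : itv_partition a b s1 -> itv_partition b c s2 ->
    polygon_length g a s1 + polygon_length g b s2 <= r.
  move=> h1 h2; rewrite -lee_fin -E.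
  apply: le_trans (polygon_length_le g _ _ _ (itv_partition_cat h1 h2)).
  by rewrite polygon_length_cat; case: h1 => _ /eqP ->.
have [s2 h2] := itv_partition_trivial _ _ bc.
have H2 s : itv_partition a b s -> (curve_length g b c <= (r - polygon_length g a s)%:E)%E.
  by move=> h1; apply: curve_length_le => s' h'; rewrite lee_fin lerBrDl H.
have [s1 h1] := itv_partition_trivial _ _ ab.
have := H2 _ h1; case E2 : (curve_length g b c) => [r2| |]//; last first.
  by have := curve_length_ge0 g _ _ bc; rewrite E2.
move=> _; rewrite -leeBrDr//; apply: curve_length_le => s hs.
by have := H2 _ hs; rewrite E2 !lee_fin; rewrite !lerBrDl addrC.
Qed.

Lemma curve_length_split g a b c : a <= b -> b <= c ->
  curve_length g a c = (curve_length g a b + curve_length g b c)%E.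
Proof.
move=> ab bc; apply/eqP; rewrite eq_le curve_length_superadd// andbT.
apply: curve_length_le => s; elim: s a ab => [|x s IH] a ab.
  by move=> _; rewrite adde_ge0// curve_length_ge0.
move=> /[dup] /itv_partition_cons xcs [/= /andP[ax xs] sc].
have [xb|bx] := leP x b.
  rewrite EFinD (le_trans (leeD (lexx _) (IH _ xb xcs)))// addeA leeD//.
  apply: le_trans (curve_length_superadd g _ _ _ (ltW ax) xb).
  by rewrite leeD// mdist_le_curve_length// ltW.
(* The first side passes over [b]; inserting [b] there can only lengthen the polygon. *)
apply: (@le_trans _ _ ((mdist (g a) (g b))%:E + (polygon_length g b (x :: s))%:E)%E).
  by rewrite -EFinD lee_fin/= addrA lerD2r; exact: metric_triangle.
rewrite leeD// ?mdist_le_curve_length// polygon_length_le//.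
by split=> //=; rewrite bx.
Qed.

Lemma curve_length_monor g a b c : a <= b -> b <= c ->
  (curve_length g a b <= curve_length g a c)%E.
Proof. by move=> ab bc; rewrite (curve_length_split _ _ _ _ ab bc) leeDl// curve_length_ge0. Qed.

Lemma curve_length_monol g a b c : a <= b -> b <= c ->
  (curve_length g b c <= curve_length g a c)%E.
Proof. by move=> ab bc; rewrite (curve_length_split _ _ _ _ ab bc) leeDr// curve_length_ge0. Qed.

Lemma curve_length_lipschitz g a b (k : R) : a <= b ->
  (forall s t : R, a <= s -> s <= t -> t <= b -> mdist (g s) (g t) <= k * (t - s)) ->
  (curve_length g a b <= (k * (b - a))%:E)%E.
Proof.
move=> _ h; apply: curve_length_le => s; rewrite lee_fin.
elim: s a h => [|x s IH] a h.
  by move=> /itv_partition_nil ->; rewrite subrr mulr0.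
move=> /[dup] /itv_partition_cons xbs [/= /andP[/ltW ax xs] sb].
have xb := itv_partition_le xbs.
rewrite (_ : k * (b - a) = k * (x - a) + k * (b - x)); last by ring.
rewrite lerD// ?h// IH// => u v xu; apply: h; exact: le_trans xu.
Qed.

(** * Arc-length parametrization *)

Section arclength.
Variables (g : R -> T) (a b : R).
Hypotheses (ab : a <= b) (cg : {within `[a, b], continuous g})
  (fg : (curve_length g a b < +oo)%E).

Let len t := fine (curve_length g a t).

Lemma curve_length_fin (s t : R) : a <= s -> s <= t -> t <= b ->
  curve_length g s t \is a fin_num.
Proof.
move=> as_ st tb; rewrite ge0_fin_numE ?curve_length_ge0//.
apply: le_lt_trans fg; apply: le_trans (curve_length_monol g _ _ _ as_ (le_trans st tb)).
exact: curve_length_monor.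
Qed.

Lemma fine_curve_lengthK t : a <= t -> t <= b -> curve_length g a t = (len t)%:E.
Proof. by move=> at_ tb; rewrite fineK// curve_length_fin. Qed.

Lemma fine_curve_length_split (s t : R) : a <= s -> s <= t -> t <= b ->
  curve_length g s t = (len t - len s)%:E.
Proof.
move=> as_ st tb; have at_ := le_trans as_ st; have sb := le_trans st tb.
have := curve_length_split g _ _ _ as_ st.
rewrite !fine_curve_lengthK//; have /fineK <- := curve_length_fin _ _ as_ st tb.
by rewrite -EFinD => -[->]; rewrite addrC addKr.
Qed.

Lemma mdist_le_fine_curve_length (s t : R) : a <= s -> s <= t -> t <= b ->
  mdist (g s) (g t) <= len t - len s.
Proof.
by move=> as_ st tb; rewrite -lee_fin -fine_curve_length_split// mdist_le_curve_length.
Qed.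

Lemma fine_curve_length_mono (s t : R) : a <= s -> s <= t -> t <= b -> len s <= len t.
Proof.
by move=> *; rewrite -subr_ge0 (le_trans _ (mdist_le_fine_curve_length _ _ _ _ _))// mdist_ge0.
Qed.

Let almost_length c d e : a <= c -> c < d -> d <= b -> 0 < e ->
  exists2 s, itv_partition c d s & len d - len c < polygon_length g c s + e.
Proof.
move=> ac cd db e0.
have : ((len d - len c - e)%:E < curve_length g c d)%E.
  by rewrite fine_curve_length_split ?(ltW cd)// lte_fin ltrBlDr ltrDl.
rewrite curve_lengthE => /ereal_sup_gt[_ [s cds <-]].
by rewrite lte_fin ltrBlDr => ?; exists s.
Qed.

(* A polygon with nearly the full length of [c, d] has a first side [c, q]; on
   [c, q] the length can then exceed the chord by at most [e].  This gives the
   right continuity of the length function, and its mirror image the left one. *)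
Lemma fine_curve_length_near_right c d e : a <= c -> c < d -> d <= b -> 0 < e ->
  exists2 q, c < q <= d & forall t, c <= t -> t <= q ->
    len t - len c <= mdist (g c) (g t) + e.
Proof.
move=> ac cd db e0; have [[|q s] cds hs] := almost_length _ _ _ ac cd db e0.
  by move: cd; rewrite (itv_partition_nil cds) ltxx.
have qds := itv_partition_cons cds; have qd := itv_partition_le qds.
have cq : c < q by case: cds => /= /andP[].
exists q => [|t ct tq]; first by rewrite cq.
have ps : polygon_length g q s <= len d - len q.
  by rewrite -lee_fin -fine_curve_length_split ?(le_trans ac (ltW cq))// polygon_length_le.
have := mdist_le_fine_curve_length _ _ (le_trans ac ct) tq (le_trans qd db).
have := metric_triangle (g c) (g t) (g q); move: hs => /=; lra.
Qed.

Lemma fine_curve_length_near_left c d e : a <= c -> c < d -> d <= b -> 0 < e ->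
  exists2 q, c <= q < d & forall t, q <= t -> t <= d ->
    len d - len t <= mdist (g t) (g d) + e.
Proof.
move=> ac cd db e0; have [s cds hs] := almost_length _ _ _ ac cd db e0.
case/lastP: s cds hs => [|s x].
  by move=> cds; move: cd; rewrite (itv_partition_nil cds) ltxx.
move=> [] /=; rewrite rcons_path last_rcons => /andP[cs sx /eqP xd].
rewrite -cats1 polygon_length_cat/=; rewrite {}xd addr0 in sx *.
have cqs : itv_partition c (last c s) s by split.
move: (last c s) cqs sx => q cqs qd hs; have cq := itv_partition_le cqs.
exists q => [|t qt td]; first by rewrite cq.
have ps : polygon_length g c s <= len q - len c.
  rewrite -lee_fin -fine_curve_length_split// ?polygon_length_le//.
  by rewrite (le_trans (ltW qd)).
have := mdist_le_fine_curve_length _ _ (le_trans ac cq) qt (le_trans td db).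
have := metric_triangle (g q) (g t) (g d); lra.
Qed.

(** The value [u] is attained at the supremum [c] of the times whose length is at most [u].
    Continuity of [g] and the estimate to the left of [c] give one inequality, the estimate to the
    right the other. *)
Lemma fine_curve_length_surj u : 0 <= u -> u <= len b ->
  exists2 t, t \in `[a, b] & len t = u.
Proof.
move=> u0 ub.
pose A := [set t | t \in `[a, b] /\ len t <= u].
have Aa : A a by split; rewrite ?bound_itvE// /len curve_lengthxx.
have hA : has_sup A.
  by split; [exists a|exists b => t [+ _]; rewrite in_itv/= => /andP[]].
pose c := sup A.
have ac : a <= c by exact: ub_le_sup (hA.2) _ Aa.
have cb : c <= b.
  by apply: ge_sup; [exists a|move=> t [+ _]; rewrite in_itv/= => /andP[]].
have cab : c \in `[a, b] by rewrite in_itv/= ac.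
have Aab t : A t -> a <= t <= b by case=> + _; rewrite in_itv/=.
exists c => //; apply/eqP; rewrite eq_le; apply/andP; split.
- apply/ler_addgt0Pr => e e0; have e20 : 0 < e / 2 by rewrite divr_gt0.
  move: ac; rewrite le_eqVlt => /predU1P[<-|ac].
    by rewrite (le_trans (Aa.2))// lerDl ltW.
  have [q /andP[aq qc] hq] := fine_curve_length_near_left _ _ _ (lexx a) ac cb e20.
  have /within_continuous_mdistP/(_ _ cab _ e20)[r r0 hr] := cg.
  have : Num.max q (c - r) < c by rewrite gt_max qc/= ltrBlDr ltrDl.
  move=> /(sup_gt (ex_intro _ a Aa))[t At]; rewrite gt_max => /andP[qt rt].
  have tc : t <= c by exact: ub_le_sup (hA.2) _ At.
  have := hq t (ltW qt) tc; have := At.2.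
  have : mdist (g c) (g t) < e / 2.
    by apply: hr; [exact: At.1|rewrite ger0_norm ?subr_ge0//; lra].
  rewrite (metric_sym (g c)); lra.
- apply/ler_addgt0Pr => e e0; have e20 : 0 < e / 2 by rewrite divr_gt0.
  move: cb; rewrite le_eqVlt => /predU1P[->|cb].
    by rewrite (le_trans ub)// lerDl ltW.
  have [q /andP[cq qb] hq] := fine_curve_length_near_right _ _ _ ac cb (lexx b) e20.
  have /within_continuous_mdistP/(_ _ cab _ e20)[r r0 hr] := cg.
  pose t := Num.min q (c + r / 2).
  have ct : c < t by rewrite lt_min cq/= ltrDl divr_gt0.
  have tq : t <= q by rewrite ge_min lexx.
  have tr : t <= c + r / 2 by rewrite ge_min lexx orbT.
  have tab : t \in `[a, b] by rewrite in_itv/= (le_trans ac (ltW ct)) (le_trans tq).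
  have ut : u < len t.
    rewrite ltNge; apply/negP => h.
    have : t <= c by apply: ub_le_sup (hA.2) _ _; split.
    by rewrite leNgt ct.
  have := hq t (ltW ct) tq.
  have : mdist (g c) (g t) < e / 2.
    by apply: hr => //; rewrite distrC ger0_norm ?subr_ge0 ?(ltW ct)//; lra.
  lra.
Qed.

(** Times of equal length are mapped to the same point, because the length in between vanishes;
    continuity of [g] carries this over to the infimum of these times. *)
Lemma arclength_paramE t : t \in `[a, b] -> arclength_param g a b (len t) = g t.
Proof.
move=> tab; rewrite /arclength_param; set A := (X in inf X).
have AE (s : R) : A s <-> s \in `[a, b] /\ len s = len t.
  split=> -[sab]; move: (sab); rewrite in_itv/= => /andP[as_ sb].
    by rewrite fine_curve_lengthK// => -[].
  by move=> st; split => //; rewrite fine_curve_lengthK// st.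
have At : A t by apply/AE.
have Ag (s : R) : A s -> g s = g t.
  move=> /AE[]; move: tab; rewrite !in_itv/= => /andP[at_ tb] /andP[as_ sb] st.
  have [le_st|/ltW le_ts] := leP s t.
    have := mdist_le_fine_curve_length _ _ as_ le_st tb; rewrite st subrr => h.
    by apply: mdist_positivity; apply/eqP; rewrite eq_le h mdist_ge0.
  have := mdist_le_fine_curve_length _ _ at_ le_ts sb; rewrite st subrr => h.
  by apply/esym/mdist_positivity; apply/eqP; rewrite eq_le h mdist_ge0.
have lbA : lbound A a by move=> s /AE[+ _]; rewrite in_itv/= => /andP[].
have hA : has_inf A by split; [exists t|exists a].
have cab : inf A \in `[a, b].
  rewrite in_itv/= lb_le_inf//=; last by exists t.
  by rewrite (le_trans (ge_inf (hA.2) At))//; move: tab; rewrite in_itv/= => /andP[].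
apply: mdist_positivity; apply/eqP; rewrite eq_le mdist_ge0 andbT.
apply/ler_addgt0Pr => e e0; rewrite add0r.
have /within_continuous_mdistP/(_ _ cab _ e0)[r r0 hr] := cg.
have : inf A < inf A + r by rewrite ltrDl.
move=> /(inf_lt (ex_intro _ t At))[s As sr].
rewrite -(Ag _ As) ltW// hr//; first by case/AE: As.
rewrite distrC ger0_norm ?subr_ge0 ?(ge_inf (hA.2) As)//; lra.
Qed.

Lemma arclength_param_lipschitz u v : 0 <= u -> u <= v -> v <= len b ->
  mdist (arclength_param g a b u) (arclength_param g a b v) <= v - u.
Proof.
move=> u0 uv vb.
have [s sab su] := fine_curve_length_surj _ u0 (le_trans uv vb).
have [t tab tv] := fine_curve_length_surj _ (le_trans u0 uv) vb.
rewrite -su -tv !arclength_paramE//; move: sab tab; rewrite !in_itv/=.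
move=> /andP[as_ sb] /andP[at_ tb].
have [le_st|lt_ts] := leP s t; first exact: mdist_le_fine_curve_length.
have := fine_curve_length_mono _ _ at_ (ltW lt_ts) sb.
have := mdist_le_fine_curve_length _ _ at_ (ltW lt_ts) sb.
rewrite metric_sym; lra.
Qed.

End arclength.
End curve_length_theory.

(** * Paths of speed at most one *)

Section unit_speed.
Context {R : realType} {T : metricType R}.

(** Only an upper bound for the speed, so that constant stretches are allowed and slowing down or
    concatenating paths preserves the property. *)
Definition speed_le1 (h : R -> T) (L : R) := forall s t,
  0 <= s -> s <= t -> t <= L -> mdist (h s) (h t) <= t - s.

Lemma speed_le1_rectifiable h L : 0 <= L -> speed_le1 h L ->
  rectifiable_path h 0 L (h 0) (h L).
Proof.
move=> L0 hh; split => //.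
  apply/within_continuous_mdistP => t; rewrite in_itv/= => /andP[t0 tL] e e0.
  exists e => // s; rewrite in_itv/= => /andP[s0 sL] ts.
  have [st|/ltW st] := leP t s.
    apply: le_lt_trans (hh _ _ t0 st sL) _.
    by move: ts; rewrite distrC ger0_norm ?subr_ge0.
  rewrite metric_sym; apply: le_lt_trans (hh _ _ s0 st tL) _.
  by move: ts; rewrite ger0_norm ?subr_ge0.
apply: (@le_lt_trans _ _ (1 * (L - 0))%:E); last exact: ltry.
by apply: curve_length_lipschitz => // s t s0 st tL; rewrite mul1r hh.
Qed.

Lemma speed_le1_curve_length (h : R -> T) L s t : speed_le1 h L ->
  0 <= s -> s <= t -> t <= L -> (curve_length h s t <= (t - s)%:E)%E.
Proof.
move=> hh s0 st tL; rewrite -[t - s]mul1r; apply: curve_length_lipschitz => // u v su uv vt.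
by rewrite mul1r hh ?(le_trans s0)// (le_trans vt).
Qed.

Lemma speed_le1_concat (h h' : R -> T) (L L' : R) : h L = h' 0 ->
  speed_le1 h L -> speed_le1 h' L' ->
  speed_le1 (fun t => if t <= L then h t else h' (t - L)) (L + L').
Proof.
move=> hL hh hh'; set k := fun t => _.
have kl t : t <= L -> k t = h t by rewrite /k => ->.
have kr t : L <= t -> k t = h' (t - L).
  rewrite le_eqVlt => /predU1P[<-|Lt]; first by rewrite /k lexx subrr hL.
  by rewrite /k leNgt Lt.
move=> s t s0 st tL; have [tl|/ltW tl] := leP t L.
  by rewrite !kl ?(le_trans st)// hh.
have tL' : t - L <= L' by lra.
have [sl|/ltW sl] := leP s L.
  rewrite kl// kr//; apply: le_trans (metric_triangle _ (h L) _) _.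
  have h1 := hh _ _ s0 sl (lexx _).
  have tl0 : 0 <= t - L by lra.
  by have := hh' _ _ (lexx _) tl0 tL'; rewrite -hL; lra.
rewrite !kr//; have sl0 : 0 <= s - L by lra.
have sltl : s - L <= t - L by lra.
have := hh' _ _ sl0 sltl tL'; lra.
Qed.

Lemma geodesic_speed_le1 (g : R -> T) x y : geodesic_path g x y -> speed_le1 g (mdist x y).
Proof.
move=> [_ _ gg] s t s0 st tL; have sL := le_trans st tL.
rewrite gg ?in_itv/= ?s0 ?(le_trans s0 st)//.
by rewrite distrC ger0_norm ?subr_ge0.
Qed.

End unit_speed.

(** * Paths of unit speed and the uniformized distance *)

Section real_lemmas.
Context {R : realType}.

(** Over [n] equal parts the increments add up to at most K L^2 / n, which is arbitrarily small.
    This stands in for an argument with derivatives. *)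
Lemma le_of_quadratic_increments (G : R -> R) (L K : R) : 0 <= L -> 0 <= K ->
  (forall s t, 0 <= s -> s <= t -> t <= L -> G t - G s <= K * (t - s) ^+ 2) ->
  G L <= G 0.
Proof.
move=> L0 K0 h; apply/ler_addgt0Pr => e e0.
pose n := Num.bound (K * L ^+ 2 / e).
have nP : K * L ^+ 2 / e < n%:R.
  by rewrite archi_boundP// divr_ge0 ?mulr_ge0 ?sqr_ge0 ?(ltW e0).
have n0 : 0 < n%:R :> R.
  by apply: le_lt_trans nP; rewrite divr_ge0 ?mulr_ge0 ?sqr_ge0 ?(ltW e0).
pose q := L / n%:R; have q0 : 0 <= q by rewrite divr_ge0 ?(ltW n0).
have qn : n%:R * q = L by rewrite /q mulrCA divff ?mulr1// gt_eqF.
have H i : (i <= n)%N -> G (i%:R * q) - G 0 <= i%:R * (K * q ^+ 2).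
  elim: i => [|i IH] ilt; first by rewrite !mul0r subrr.
  have iq : i.+1%:R * q = i%:R * q + q by rewrite -natr1 mulrDl mul1r.
  have iL : i%:R * q + q <= L by rewrite -iq -qn ler_wpM2r// ler_nat.
  have := h (i%:R * q) (i%:R * q + q); rewrite mulr_ge0// lerDl q0 => /(_ isT isT iL).
  rewrite [i%:R * q + q - _]addrC addKr -iq.
  have -> : i.+1%:R * (K * q ^+ 2) = i%:R * (K * q ^+ 2) + K * q ^+ 2.
    by rewrite -natr1 mulrDl mul1r.
  have := IH (ltnW ilt); lra.
have := H n (leqnn n); rewrite qn.
have : n%:R * (K * q ^+ 2) <= e.
  rewrite (_ : _ * _ = K * L ^+ 2 / n%:R).
    by rewrite ler_pdivrMr// [e * _]mulrC -ler_pdivrMr// ltW.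
  by rewrite /q; field; rewrite gt_eqF.
lra.
Qed.

(* [P t - P s] is an upper bound for the integral of [f] over [s, t].  Since only
   constants below [f] are tested, this is stable under concatenation and
   reversal of paths without any change of variables in integrals. *)
Definition upper_primitive (f P : R -> R) (L : R) := forall s t m : R,
  0 <= s -> s <= t -> t <= L -> (forall u, s <= u -> u <= t -> m <= f u) ->
  m * (t - s) <= P t - P s.

Section lipschitz_integral.
Variables (f : R -> R) (L k : R).
Hypotheses (L0 : 0 <= L) (k0 : 0 <= k).
Hypothesis f_lip : forall u v, 0 <= u -> u <= v -> v <= L -> `|f u - f v| <= k * (v - u).
Let mu := @lebesgue_measure R.

Let f_int : mu.-integrable `[0, L] (EFin \o f).
Proof.
apply: continuous_compact_integrable; first exact: segment_compact.
(* The modulus of continuity is e / (k + 1), since [k] itself may be [0]. *)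
have k1 : 0 < k + 1 by rewrite ltr_wpDl.
apply/(within_continuous_mdistP (f : R -> R^o)) => t.
rewrite in_itv/= => /andP[t0 tL] e e0.
exists (e / (k + 1)); first by rewrite divr_gt0.
move=> s; rewrite in_itv/= => /andP[s0 sL]; rewrite ltr_pdivlMr// => ts.
have : `|f s - f t| <= k * `|t - s|.
  have [st|/ltW st] := leP t s.
    by rewrite distrC [`|t - s|]distrC (@ger0_norm _ (s - t)) ?subr_ge0// f_lip.
  by rewrite (@ger0_norm _ (t - s)) ?subr_ge0// f_lip.
have : k * `|t - s| <= (k + 1) * `|t - s| by rewrite ler_wpM2r// lerDl.
rewrite /mdist/= mulrC [(k + 1) * _]mulrC; lra.
Qed.

Let J t := (\int[mu]_(u in `[0, t]) f u)%R.

Let JB s t : 0 <= s -> s <= t -> t <= L ->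
  J t - J s = (\int[mu]_(u in `]s, t]) f u)%R.
Proof.
move=> s0 st tL; rewrite /J Rintegral_itvB ?bnd_simp//.
by apply: integrableS f_int => //; apply: subset_itv; rewrite bnd_simp.
Qed.

Let f_intS s t : 0 <= s -> t <= L -> mu.-integrable `]s, t] (EFin \o f).
Proof.
by move=> s0 tL; apply: integrableS f_int => //; apply: subset_itv; rewrite bnd_simp.
Qed.

Let int_cst s t m : s <= t ->
  mu.-integrable `]s, t] (EFin \o cst m) /\ (\int[mu]_(u in `]s, t]) m)%R = m * (t - s).
Proof.
move=> st; split.
  apply: integrableS (continuous_compact_integrable (@segment_compact _ s t) _) => //.
    by apply: subset_itv; rewrite bnd_simp.
  by move=> ?; exact: cvg_cst.
have muE : mu `]s, t]%classic = (t - s)%:E.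
  rewrite [LHS]lebesgue_measure_itv/= lte_fin; case: ltP => // ts.
  by rewrite (@le_anti _ _ s t) ?st// subrr.
by rewrite Rintegral_cst//; exact: (congr1 (fun z => m * fine z) muE).
Qed.

Lemma upper_primitive_integral : upper_primitive f J L.
Proof.
move=> s t m s0 st tL hm; have [im <-] := int_cst _ _ m st; rewrite JB//.
apply: le_Rintegral => //; first exact: f_intS.
by move=> u /=; rewrite in_itv/= => /andP[/ltW su ut]; exact: hm.
Qed.

Lemma integral_increment_le s t m : 0 <= s -> s <= t -> t <= L ->
  (forall u, s <= u -> u <= t -> f u <= m) -> J t - J s <= m * (t - s).
Proof.
move=> s0 st tL hm; have [im <-] := int_cst _ _ m st; rewrite JB//.
apply: le_Rintegral => //; first exact: f_intS.
by move=> u /=; rewrite in_itv/= => /andP[/ltW su ut]; exact: hm.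
Qed.

End lipschitz_integral.
End real_lemmas.
Arguments upper_primitive_integral {R f L k}.
Arguments integral_increment_le {R f L k}.

(** * The weight and nearly optimal paths *)

Section uniformization_weight.
Context {R : realType} {Z : metricType R} (z0 : Z) (eps : R).
Hypothesis eps0 : 0 < eps.
Local Notation rho := (rho_eps z0 eps).
Local Notation D := (d_eps z0 eps).

Lemma rho_eps_gt0 z : 0 < rho z.
Proof. exact: expR_gt0. Qed.

Lemma rho_eps_le1 z : rho z <= 1.
Proof. by rewrite -[leRHS]expR0 ler_expR mulNr oppr_le0 mulr_ge0 ?mdist_ge0// ltW. Qed.

(** Triangle inequality at [z0]. This Harnack-type comparison makes the weight constant up to a
    factor over bounded distances. *)
Lemma rho_eps_le_expR x y : rho x <= expR (eps * mdist x y) * rho y.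
Proof.
rewrite -expRD ler_expR.
have : eps * mdist y z0 <= eps * (mdist x y + mdist x z0).
  by rewrite ler_pM2l// (metric_sym x y) metric_triangle.
lra.
Qed.

(** The inequality 1 - t <= exp(- t) turns the multiplicative comparison of weights into an additive
    one. *)
Lemma rho_eps_lipschitz_mul x y : rho x - rho y <= eps * mdist x y * rho x.
Proof.
have : 1 - eps * mdist x y <= expR (- (eps * mdist x y)) by exact: expR_ge1Dx.
rewrite -(ler_pM2r (rho_eps_gt0 x)) => h.
have : expR (- (eps * mdist x y)) * rho x <= rho y.
  by rewrite expRN mulrC ler_pdivrMr ?expR_gt0// mulrC rho_eps_le_expR.
lra.
Qed.

Lemma rho_eps_lipschitz x y : `|rho x - rho y| <= eps * mdist x y.
Proof.
have H a b : rho a - rho b <= eps * mdist a b.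
  apply: (le_trans (rho_eps_lipschitz_mul a b)).
  by rewrite ler_piMr ?rho_eps_le1// mulr_ge0 ?mdist_ge0// ltW.
by rewrite ler_norml H lerNl opprB metric_sym H.
Qed.

Lemma path_integral_ge0 g a b : 0 <= path_integral rho g a b.
Proof. by apply: Rintegral_ge0 => u _; rewrite ltW// rho_eps_gt0. Qed.

Lemma d_eps_le_path_integral g a b x y : rectifiable_path g a b x y ->
  D x y <= path_integral rho g a b.
Proof.
move=> gab; apply: ge_inf; last by exists g, a, b.
by exists 0 => _ [g' [a' [b' [_ ->]]]]; exact: path_integral_ge0.
Qed.

Lemma rho_arclength_param_lipschitz g a b x y : rectifiable_path g a b x y ->
  forall u v, 0 <= u -> u <= v -> v <= fine (curve_length g a b) ->
  `|rho (arclength_param g a b u) - rho (arclength_param g a b v)| <= eps * (v - u).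
Proof.
move=> [ab cg _ _ fg] u v u0 uv vb.
apply: le_trans (rho_eps_lipschitz _ _) _; rewrite ler_pM2l//.
exact: arclength_param_lipschitz.
Qed.

(* Over [s, t] the left side grows by at most, and the right side by at least,
   [rho (h s) * (t - s)], up to [eps * (t - s) ^+ 2]. *)
Lemma path_integral_le_upper_primitive h P L : 0 <= L -> speed_le1 h L ->
  upper_primitive (rho \o h) P L -> path_integral rho h 0 L <= P L - P 0.
Proof.
move=> L0 hh hP; have rp := speed_le1_rectifiable _ _ L0 hh.
have [_ ch _ _ fh] := rp; have slip := rho_arclength_param_lipschitz _ _ _ _ _ rp.
pose len t := fine (curve_length h 0 t); pose s_ := arclength_param h 0 L.
pose J t := (\int[lebesgue_measure]_(u in `[0%R, t]) (rho (s_ u)))%R.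
have len0 : len 0 = 0 by rewrite /len curve_lengthxx.
have lenP s t : 0 <= s -> s <= t -> t <= L ->
    [/\ 0 <= len s, len s <= len t, len t <= len L & len t - len s <= t - s].
  move=> s0 st tL; have sL := le_trans st tL; have t0 := le_trans s0 st.
  have mono := fine_curve_length_mono h 0 L fh; split.
  - by rewrite -[X in X <= _]len0; exact: mono.
  - exact: mono.
  - exact: mono.
  rewrite -lee_fin -(fine_curve_length_split h 0 L fh)// -[t - s]mul1r.
  apply: curve_length_lipschitz => // u v su uv vt; rewrite mul1r hh//.
    exact: le_trans su.
  exact: le_trans tL.
have J0 : J 0 = 0 by rewrite /J set_itv1 Rintegral_set1.
have : J (len L) - P L <= J (len 0) - P 0; last by rewrite len0 J0 /J /len/= /path_integral; lra.
apply: (@le_of_quadratic_increments _ (fun t => J (len t) - P t) L (eps + eps)) => //.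
  by rewrite addr_ge0// ltW.
move=> s t s0 st tL; have [ls lst ltL ltls] := lenP s t s0 st tL.
have sL := le_trans st tL.
have hs : s_ (len s) = h s by rewrite /s_ arclength_paramE// in_itv/= s0.
have rs0 := rho_eps_gt0 (h s).
have e2 : 0 <= rho (h s) + eps * (t - s) by rewrite addr_ge0 ?(ltW rs0)// mulr_ge0 ?subr_ge0// ltW.
have HJ : J (len t) - J (len s) <= (rho (h s) + eps * (t - s)) * (t - s).
  apply: (@le_trans _ _ ((rho (h s) + eps * (t - s)) * (len t - len s))); last first.
    by rewrite ler_wpM2l.
  apply: (integral_increment_le (L := len L) (k := eps)) => //.
    exact: ltW.
  move=> u su ut; have := slip (len s) u ls su (le_trans ut ltL).
  rewrite -/s_ hs ler_norml => /andP[h1 _].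
  have : eps * (u - len s) <= eps * (t - s) by rewrite ler_pM2l//; lra.
  lra.
have HP : (rho (h s) - eps * (t - s)) * (t - s) <= P t - P s.
  apply: hP => // u su ut /=.
  have := rho_eps_lipschitz (h s) (h u); rewrite ler_norml => /andP[_ h1].
  have : eps * mdist (h s) (h u) <= eps * (t - s).
    rewrite ler_pM2l// (le_trans (hh _ _ s0 su (le_trans ut tL)))//; lra.
  lra.
have -> : (eps + eps) * (t - s) ^+ 2 = (rho (h s) + eps * (t - s)) * (t - s) -
    (rho (h s) - eps * (t - s)) * (t - s) by ring.
have -> : J (len t) - P t - (J (len s) - P s) =
  (J (len t) - J (len s)) - (P t - P s) by ring.
exact: lerB.
Qed.

Lemma d_eps_le_upper_primitive h P L : 0 <= L -> speed_le1 h L ->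
  upper_primitive (rho \o h) P L -> D (h 0) (h L) <= P L - P 0.
Proof.
move=> L0 hh hP; apply: le_trans (path_integral_le_upper_primitive _ _ _ L0 hh hP).
exact/d_eps_le_path_integral/speed_le1_rectifiable.
Qed.

Hypothesis geoZ : geodesic_space Z.

(** A nearly optimal path is taken in its arc-length parametrization, with the running integral of
    the weight as [P]. Later arguments work with [P] and no longer with integrals. *)
Lemma d_eps_approx x y e : 0 < e -> exists (h : R -> Z) (P : R -> R) (L : R),
  [/\ 0 <= L, speed_le1 h L, h 0 = x /\ h L = y, upper_primitive (rho \o h) P L &
      P L - P 0 < D x y + e].
Proof.
move=> e0; have [g0 gg0] := geoZ x y.
(* A geodesic shows that the infimum is taken over a non-empty set. *)
have hinf : has_inf [set r | exists (g : R -> Z) (a b : R),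
    rectifiable_path g a b x y /\ r = path_integral rho g a b].
  split; last by exists 0 => _ [g' [a' [b' [_ ->]]]]; exact: path_integral_ge0.
  exists (path_integral rho g0 0 (mdist x y)), g0, 0, (mdist x y); split => //.
  have [g00 g01 _] := gg0; rewrite -{2}g00 -{2}g01.
  by apply: speed_le1_rectifiable; [exact: mdist_ge0|exact: geodesic_speed_le1 gg0].
have := ltrDl (D x y) e; rewrite e0 => /(inf_lt (hinf.1))[_ [g [a [b [rp ->]]]] lt_e].
have [ab cg ga gb fg] := rp.
have L0 : 0 <= fine (curve_length g a b) by rewrite fine_ge0// curve_length_ge0.
have slip := rho_arclength_param_lipschitz _ _ _ _ _ rp.
exists (arclength_param g a b),
  (fun t => \int[lebesgue_measure]_(u in `[0%R, t]) (rho (arclength_param g a b u)))%R,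
  (fine (curve_length g a b)); split => //.
- by move=> s t s0 st tL; exact: arclength_param_lipschitz.
- split; last by rewrite arclength_paramE// bound_itvE.
  have := arclength_paramE g a b cg fg a.
  by rewrite bound_itvE ab curve_lengthxx/= => /(_ isT) ->.
- exact: (upper_primitive_integral (ltW eps0) slip).
- by rewrite [X in _ - X](_ : _ = 0) ?subr0// set_itv1 Rintegral_set1.
Qed.

End uniformization_weight.

(** * Two-sided estimates for [d_eps] and the metric axioms *)

Section uniformized_distance.
Context {R : realType} {Z : metricType R} (z0 : Z) (eps : R).
Hypotheses (eps0 : 0 < eps) (geoZ : geodesic_space Z).
Local Notation rho := (rho_eps z0 eps).
Local Notation D := (d_eps z0 eps).

(** Along a geodesic from [x] the weight is at most exp(eps K) rho(x), so a linear function serves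
    as upper primitive. *)
Lemma d_eps_le (K : R) x y : mdist x y <= K ->
  D x y <= expR (eps * K) * rho x * mdist x y.
Proof.
move=> xyK; have [g gg] := geoZ x y; have [g0 g1 _] := gg.
have sp := geodesic_speed_le1 _ _ _ gg.
rewrite -{1}g0 -{1}g1.
have -> : expR (eps * K) * rho x * mdist x y =
  expR (eps * K) * rho x * mdist x y - expR (eps * K) * rho x * 0 by rewrite mulr0 subr0.
apply: (d_eps_le_upper_primitive _ _ eps0 _ (fun t => expR (eps * K) * rho x * t)) => //.
  exact: mdist_ge0.
move=> s t m s0 st tL hm; rewrite -mulrBr ler_wpM2r ?subr_ge0//.
apply: le_trans (hm s (lexx _) st) _ => /=.
apply: le_trans (rho_eps_le_expR z0 _ eps0 _ x) _.
rewrite ler_pM2r ?rho_eps_gt0// ler_expR ler_pM2l// metric_sym -g0.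
apply: le_trans (sp 0 s (lexx _) s0 (le_trans st tL)) _.
by rewrite subr0 (le_trans _ xyK)// (le_trans st).
Qed.

Lemma upper_primitive_mono h P L s t : upper_primitive (rho \o h) P L ->
  0 <= s -> s <= t -> t <= L -> P s <= P t.
Proof.
move=> hP s0 st tL; have := hP s t 0 s0 st tL.
rewrite mul0r subr_ge0; apply => u _ _ /=; exact/ltW/rho_eps_gt0.
Qed.

(** During a time [k] the path moves by at most [k], so the weight falls by at most the factor
    exp(-eps k). *)
Lemma upper_primitive_increment_ge h P L k s t : speed_le1 h L ->
  upper_primitive (rho \o h) P L -> 0 <= s -> s <= t -> t <= L -> t - s <= k ->
  expR (- (eps * k)) * rho (h s) * (t - s) <= P t - P s.
Proof.
move=> hh hP s0 st tL tsk; apply: hP => // u su ut /=.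
rewrite expRN mulrC ler_pdivrMr ?expR_gt0// mulrC.
apply: le_trans (rho_eps_le_expR z0 _ eps0 _ (h u)) _.
rewrite ler_pM2r ?rho_eps_gt0// ler_expR ler_pM2l//.
apply: le_trans (hh _ _ s0 su (le_trans ut tL)) _; lra.
Qed.

(** Only the initial stretch of duration min(1, d(x,y)) of a nearly optimal path is counted; the
    rest contributes a nonnegative amount. *)
Lemma d_eps_ge x y : expR (- eps) * rho x * Num.min 1 (mdist x y) <= D x y.
Proof.
apply/ler_addgt0Pr => e e0.
have [h [P [L [L0 hh [hx hy] hP lt_e]]]] := d_eps_approx z0 eps eps0 geoZ x y e e0.
set q := Num.min _ _.
have q0 : 0 <= q by rewrite le_min ler01 mdist_ge0.
have qL : q <= L.
  have := hh 0 L (lexx _) L0 (lexx _); rewrite hx hy subr0; apply: le_trans.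
  by rewrite ge_min lexx orbT.
have q1 : q - 0 <= 1 by rewrite subr0 ge_min lexx.
have := upper_primitive_increment_ge h P L 1 0 q hh hP (lexx _) q0 qL q1.
rewrite mulr1 hx subr0 => hq.
have := upper_primitive_mono h P L q L hP q0 qL (lexx _); lra.
Qed.

Lemma d_eps_ge0 x y : 0 <= D x y.
Proof.
apply: le_trans (d_eps_ge x y).
by rewrite !mulr_ge0 ?expR_ge0// ?le_min ?ler01 ?mdist_ge0// ltW// rho_eps_gt0.
Qed.

(** The condition [r <= 1] excludes the case in which the minimum in [d_eps_ge] equals 1. *)
Lemma d_eps_lt_mdist (x y : Z) r : 0 <= r -> r <= 1 ->
  D x y < expR (- eps) * rho x * r -> mdist x y < r.
Proof.
move=> r0 r1 /(le_lt_trans (d_eps_ge x y)).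
rewrite ltr_pM2l ?mulr_gt0 ?expR_gt0 ?rho_eps_gt0// gt_min.
by case/orP => // /lt_le_trans/(_ r1); rewrite ltxx.
Qed.

(** A nearly optimal path is reversed; the reversed path has the upper primitive [- P (L - t)]. *)
Lemma d_eps_sym_le x y : D y x <= D x y.
Proof.
apply/ler_addgt0Pr => e e0.
have [h [P [L [L0 hh [hx hy] hP lt_e]]]] := d_eps_approx z0 eps eps0 geoZ x y e e0.
have E : P L - P 0 = - P (L - L) - - P (L - 0) by rewrite subrr subr0 opprK addrC.
apply/ltW; apply: le_lt_trans lt_e.
have := d_eps_le_upper_primitive z0 eps eps0 (fun t => h (L - t)) (fun t => - P (L - t)) L L0.
rewrite subr0 subrr hx hy E; rewrite subr0 subrr; apply.
  move=> s t s0 st tL; rewrite metric_sym (le_trans (hh _ _ _ _ _))//; lra.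
move=> s t m s0 st tL hm; rewrite opprK [_ + P _]addrC.
rewrite (_ : t - s = (L - s) - (L - t)); last by ring.
apply: hP; [lra..|move=> u tu us].
by have := hm (L - u); rewrite /= subKr; apply; lra.
Qed.

Lemma d_eps_triangle y x z : D x z <= D x y + D y z.
Proof.
apply/ler_addgt0Pr => e e0; have e20 : 0 < e / 2 by rewrite divr_gt0.
have [h [P [L [L0 hh [hx hy] hP lt_e]]]] := d_eps_approx z0 eps eps0 geoZ x y _ e20.
have [h' [P' [L' [L0' hh' [hx' hy'] hP' lt_e']]]] := d_eps_approx z0 eps eps0 geoZ y z _ e20.
pose k t := if t <= L then h t else h' (t - L).
(* [P'] is shifted by a constant so that the two upper primitives agree at time [L]. *)
pose Q t := if t <= L then P t else P L + (P' (t - L) - P' 0).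
have kL t : L <= t -> k t = h' (t - L).
  rewrite le_eqVlt => /predU1P[<-|Lt]; first by rewrite /k lexx subrr hy hx'.
  by rewrite /k leNgt Lt.
have QL t : L <= t -> Q t = P L + (P' (t - L) - P' 0).
  rewrite le_eqVlt => /predU1P[<-|Lt]; first by rewrite /Q lexx subrr subrr addr0.
  by rewrite /Q leNgt Lt.
have kl t : t <= L -> k t = h t by rewrite /k => ->.
have Ql t : t <= L -> Q t = P t by rewrite /Q => ->.
have LL : L <= L + L' by rewrite lerDl.
suff : D (k 0) (k (L + L')) <= Q (L + L') - Q 0.
  rewrite kl// kL// QL// Ql// [L + L']addrC addrK hx hy'; lra.
apply: d_eps_le_upper_primitive => //; first exact: addr_ge0.
  by apply: speed_le1_concat; rewrite ?hy ?hx'.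
move=> s t m s0 st tL hm; have [tl|/ltW tl] := leP t L.
  rewrite !Ql ?(le_trans st)//; apply: hP => // u su ut.
  by have := hm u su ut; rewrite /= kl// (le_trans ut).
have tL' : t - L <= L' by lra.
(* If the interval contains [L], the bounds on the two sides of [L] are added. *)
have [sl|/ltW sl] := leP s L.
  rewrite (QL t)// (Ql s)//.
  have : m * (L - s) <= P L - P s.
    apply: hP => // u su uL; have := hm u su (le_trans uL tl); by rewrite /= kl.
  have : m * ((t - L) - 0) <= P' (t - L) - P' 0.
    apply: hP' => //; first lra.
    move=> u u0 ut; have := hm (u + L); rewrite /= kL; last by rewrite lerDr.
    rewrite addrK; apply; lra.
  lra.
rewrite !QL//.
have : m * ((t - L) - (s - L)) <= P' (t - L) - P' (s - L).
  apply: hP'; [lra..|].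
  move=> u u0 ut; have := hm (u + L); rewrite /= kL ?addrK; last lra.
  apply; lra.
lra.
Qed.

Lemma d_eps_is_distance : is_distance D.
Proof.
split.
- move=> x; apply/eqP; rewrite eq_le d_eps_ge0 andbT.
  by have := d_eps_le 0 x x; rewrite mdistxx mulr0; apply.
- move=> x y xy0; have := d_eps_ge x y; rewrite xy0.
  rewrite pmulr_rle0 ?mulr_gt0 ?expR_gt0 ?rho_eps_gt0// ge_min ler10/= => h.
  by apply: mdist_positivity; apply/eqP; rewrite eq_le h mdist_ge0.
- by move=> x y; apply/eqP; rewrite eq_le !d_eps_sym_le.
- exact: d_eps_triangle.
Qed.

End uniformized_distance.

(** * Transfer of [d_eps] along a rough isometry *)

Section transfer.
Context {R : realType} {X Y : metricType R} (x0 : X) (y0 : Y) (eps tau : R).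
Hypotheses (eps0 : 0 < eps) (geoX : geodesic_space X) (geoY : geodesic_space Y).
Variable Phi : Y -> X.
Hypotheses (tau0 : 0 <= tau)
  (Phi_le : forall y y', mdist (Phi y) (Phi y') <= mdist y y' + tau)
  (Phi_base : forall y, mdist y y0 <= mdist (Phi y) x0 + tau).
Local Notation rhoX := (rho_eps x0 eps).
Local Notation rhoY := (rho_eps y0 eps).
Local Notation DX := (d_eps x0 eps).
Local Notation DY := (d_eps y0 eps).

Lemma rho_eps_transfer y : rhoX (Phi y) <= expR (eps * tau) * rhoY y.
Proof.
rewrite -expRD ler_expR.
have : eps * mdist y y0 <= eps * (mdist (Phi y) x0 + tau) by rewrite ler_pM2l.
lra.
Qed.

(** A step of length at most 2 has an image of length at most 2 + tau. The exponent is the sum of 2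
    + tau (weight along the image), tau (weights of a point and its image) and 2 (weight along the
    original step). *)
Definition transfer_cst := (2 + tau) * expR (eps * (4 + 2 * tau)).

Lemma transfer_cst_gt0 : 0 < transfer_cst.
Proof. by rewrite mulr_gt0 ?expR_gt0// ltr_wpDr. Qed.

Lemma d_eps_transfer_near y y' : mdist y y' <= 2 ->
  DX (Phi y) (Phi y') <= transfer_cst * (expR (- (eps * 2)) * rhoY y).
Proof.
move=> yy2; have p2 : mdist (Phi y) (Phi y') <= 2 + tau.
  by apply: le_trans (Phi_le _ _) _; rewrite lerD2r.
apply: le_trans (d_eps_le x0 _ eps0 geoX _ _ _ p2) _.
apply: (@le_trans _ _ (expR (eps * (2 + tau)) * (expR (eps * tau) * rhoY y) * (2 + tau))).
  apply: ler_pM => //; rewrite ?mulr_ge0 ?expR_ge0 ?mdist_ge0 ?(ltW (rho_eps_gt0 _ _ _))//.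
  by rewrite ler_wpM2l ?expR_ge0 ?rho_eps_transfer.
have E : eps * (4 + 2 * tau) = eps * (2 + tau) + eps * tau + eps * 2 by ring.
rewrite /transfer_cst E.
rewrite [expR (_ + eps * 2)]expRD expRD expRN.
have e2 := expR_gt0 (eps * 2).
rewrite le_eqVlt; apply/orP; left; apply/eqP; field; rewrite gt_eqF//.
Qed.

(** Steps of duration between 1 and 2 are used: the increment of [P] over such a step is at least a
    multiple of the weight, and this pays for the additive error [tau] of [Phi]. *)
Lemma d_eps_transfer_far y y' : 1 <= mdist y y' ->
  DX (Phi y) (Phi y') <= transfer_cst * DY y y'.
Proof.
move=> yy1; rewrite -ler_pdivrMl ?transfer_cst_gt0//; apply/ler_addgt0Pr => e e0.
have [h [P [L [L0 hh [hy hy'] hP lt_e]]]] := d_eps_approx y0 eps eps0 geoY y y' e e0.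
apply: le_trans (ltW lt_e); rewrite ler_pdivrMl ?transfer_cst_gt0// -{1}hy -{1}hy'.
have step s t : 0 <= s -> 1 <= t - s -> t - s <= 2 -> t <= L ->
    DX (Phi (h s)) (Phi (h t)) <= transfer_cst * (P t - P s).
  move=> s0 ts1 ts2 tL; have st : s <= t by lra.
  have st2 : mdist (h s) (h t) <= 2 by apply: le_trans (hh _ _ s0 st tL) _.
  apply: le_trans (d_eps_transfer_near _ _ st2) _.
  rewrite ler_wpM2l ?(ltW transfer_cst_gt0)//.
  have := upper_primitive_increment_ge _ _ eps0 h P L 2 s t hh hP s0 st tL ts2.
  by apply: le_trans; rewrite ler_peMr// mulr_ge0 ?expR_ge0// ltW// rho_eps_gt0.
(* Unit steps are removed while more than 2 is left, so the last step also has duration at least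
   1. *)
have H n s : 0 <= s -> 1 <= L - s -> L - s <= n%:R + 2 ->
    DX (Phi (h s)) (Phi (h L)) <= transfer_cst * (P L - P s).
  elim: n s => [|n IH] s s0 Ls Ln.
    by apply: step => //; move: Ln; rewrite add0r.
  have [Ls2|Ls2] := leP (L - s) 2; first exact: step.
  apply: le_trans (d_eps_triangle _ _ eps0 geoX (Phi (h (s + 1))) _ _) _.
  have -> : P L - P s = (P (s + 1) - P s) + (P L - P (s + 1)) by ring.
  rewrite mulrDr lerD//.
    by apply: step => //; lra.
  by apply: IH; move: Ln; rewrite -?natr1; lra.
have L1 : 1 <= L.
  by apply: le_trans yy1 _; rewrite -hy -hy' -[leRHS]subr0; exact: hh.
apply: (H (Num.bound L)) => //; rewrite subr0//.
by have := archi_boundP L0; lra.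
Qed.

(** The additive weight accounts for nearby points, whose images may be [tau] apart. It is harmless
    along sequences with vanishing weights. *)
Lemma d_eps_transfer y y' : DX (Phi y) (Phi y') <= transfer_cst * (DY y y' + rhoY y).
Proof.
have c0 := transfer_cst_gt0; have r0 := rho_eps_gt0 y0 eps y.
have [yy1|yy1] := leP 1 (mdist y y').
  apply: le_trans (d_eps_transfer_far _ _ yy1) _.
  by rewrite ler_pM2l// lerDl ltW.
apply: le_trans (d_eps_transfer_near y y' _) _; first by lra.
rewrite ler_pM2l//; apply: (@le_trans _ _ (rhoY y)).
  by rewrite ler_piMl ?ltW// -expR0 ltr_expR oppr_lt0 mulr_gt0.
by rewrite lerDr d_eps_ge0.
Qed.

End transfer.

(** * Boundary points *)

Section metric_sequences.
Context {R : realType} {T : metricType R}.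
Implicit Types (u : nat -> T) (x z : T).

Lemma cvg_mdistP u x : u @ \oo --> x <->
  (forall e : R, 0 < e -> exists N, forall n, (N <= n)%N -> mdist x (u n) < e).
Proof.
split=> [/metricType_numDomainType.cvgrPdist_lt h e e0|h].
  by have [N _ hN] := h e e0; exists N => n; exact: hN.
apply/metricType_numDomainType.cvgrPdist_lt => e e0.
by have [N hN] := h e e0; exists N => // n /=; exact: hN.
Qed.

Lemma cauchy_mdistP u : cauchy (u @ \oo) <->
  (forall e : R, 0 < e -> exists N, forall m n, (N <= m)%N -> (N <= n)%N -> mdist (u m) (u n) < e).
Proof.
split=> [cu e e0|h].
  have [[A B] /= [[N1 _ h1] [N2 _ h2]] hAB] := cauchy_seq_dist (CauchySequence cu) e0.
  exists (maxn N1 N2) => m n; rewrite !geq_max => /andP[m1 m2] /andP[n1 n2].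
  by apply: (hAB (m, n)); split; [exact: h1|exact: h2].
apply/cauchy_ballP => e e0; near_simpl.
have [N hN] := h e e0.
exists ([set n | (N <= n)%N], [set n | (N <= n)%N]) => /=; first by split; exists N.
by move=> -[m n] /= [mN nN]; rewrite ballEmdist/=; exact: hN.
Qed.

Lemma cauchy_dist_le (u v : cauchy_sequence T) c N :
  (forall n, (N <= n)%N -> mdist (u n) (v n) <= c) -> cauchy_dist u v <= c.
Proof.
move=> h; apply: limr_le; first exact: is_cvg_cauchy_dist.
by exists N => // n /=; exact: h.
Qed.

Lemma cauchy_dist_ge (u v : cauchy_sequence T) c N :
  (forall n, (N <= n)%N -> c <= mdist (u n) (v n)) -> c <= cauchy_dist u v.
Proof.
move=> h; apply: limr_ge; first exact: is_cvg_cauchy_dist.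
by exists N => // n /=; exact: h.
Qed.

Definition completion_class (u : cauchy_sequence T) : completion T :=
  \pi_(completion T)%qT u.

Lemma to_completionE x :
  to_completion x = completion_class (CauchySequence (cauchy_cst x)).
Proof. by []. Qed.

(** By the triangle inequality, replacing the chosen representatives by equivalent sequences does
    not change the distance. *)
Lemma completion_distE (u v : cauchy_sequence T) :
  mdist (completion_class u) (completion_class v) = cauchy_dist u v.
Proof.
have rK w : cauchy_dist (repr (completion_class w)) w = 0.
  by apply/eqP; have /eqP := reprK (completion_class w); rewrite eqmodE.
rewrite /mdist/= /completion_dist; set u' := repr _; set v' := repr _.
have hu : cauchy_dist u' u = 0 by exact: rK.
have hv : cauchy_dist v' v = 0 by exact: rK.
apply/eqP; rewrite eq_le; apply/andP; split.
  apply: le_trans (cauchy_dist_triangle u _ _) _; rewrite hu add0r.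
  by apply: le_trans (cauchy_dist_triangle v _ _) _; rewrite (cauchy_dist_sym v) hv addr0.
apply: le_trans (cauchy_dist_triangle u' _ _) _; rewrite (cauchy_dist_sym u) hu add0r.
by apply: le_trans (cauchy_dist_triangle v' _ _) _; rewrite hv addr0.
Qed.

Lemma boundary_piP (u : cauchy_sequence T) :
  boundary (completion_class u) <-> ~ exists x, u @ \oo --> x.
Proof.
split => h.
  move=> [x /cvg_mdistP ux]; apply: h; exists x => //.
  apply: mdist_positivity; rewrite completion_distE; apply/eqP.
  rewrite eq_le cauchy_dist_ge0 andbT; apply/ler_addgt0Pr => e e0; rewrite add0r.
  have [N hN] := ux e e0; apply: (@cauchy_dist_le _ _ _ N) => n Nn.
  exact/ltW/hN.
move=> [x _ xu]; apply: h; exists x; apply/cvg_mdistP => e e0.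
have /cauchy_mdistP cu := cauchy_seqP u.
have e20 : 0 < e / 2 by rewrite divr_gt0.
have [N hN] := cu _ e20; exists N => n Nn.
have : cauchy_dist (CauchySequence (cauchy_cst x)) u = 0.
  by rewrite -completion_distE -to_completionE xu mdistxx.
rewrite ltNge => h0; apply/negP => xe.
(* One term at distance at least [e] from [x] keeps all terms from [N] on at distance at least
   [e / 2]. *)
have : e / 2 <= cauchy_dist (CauchySequence (cauchy_cst x)) u.
  apply: (@cauchy_dist_ge _ _ _ N) => m Nm /=.
  have := metric_triangle x (u m) (u n); have := hN m n Nm Nn; lra.
by rewrite h0 leNgt e20.
Qed.

Lemma boundary_dist_le u z c N : cauchy (u @ \oo) -> ~ (exists x, u @ \oo --> x) ->
  (forall n, (N <= n)%N -> mdist z (u n) <= c) -> boundary_dist z <= c.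
Proof.
move=> cu /(boundary_piP (CauchySequence cu)) bu h.
apply: (@le_trans _ _ (mdist (to_completion z) (completion_class (CauchySequence cu)))).
  apply: ge_inf; first by exists 0 => _ [p _ <-]; exact: mdist_ge0.
  by exists (completion_class (CauchySequence cu)).
rewrite to_completionE completion_distE; exact: (@cauchy_dist_le _ _ _ N).
Qed.

(** Non-completeness provides a boundary point; the infimum of an empty set would be [0] by
    convention. *)
Lemma boundary_dist_ge z c : ~ complete_space T ->
  (forall u, cauchy (u @ \oo) -> ~ (exists x, u @ \oo --> x) -> forall e, 0 < e ->
     exists N, forall n, (N <= n)%N -> c <= mdist z (u n) + e) ->
  c <= boundary_dist z.
Proof.
move=> nc h; apply: lb_le_inf.
  have [u [cu nu]] : exists u, cauchy (u @ \oo) /\ ~ exists x, u @ \oo --> x.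
    apply/not_existsP => /= H; apply: nc => u _ cu.
    by apply: contrapT => nx; apply: (H u); split => // -[x ux]; apply: nx; exists x.
  exists (mdist (to_completion z) (completion_class (CauchySequence cu))).
  by exists (completion_class (CauchySequence cu)) => //; apply/boundary_piP.
move=> _ [p bp <-]; rewrite -[p]reprK in bp *; move/boundary_piP: bp => np.
rewrite to_completionE completion_distE; apply/ler_addgt0Pr => e e0.
have [N hN] := h _ (cauchy_seqP (repr p)) np e e0.
rewrite -lerBlDr; apply: (@cauchy_dist_ge _ _ _ N) => n Nn.
by rewrite lerBlDr; exact: hN.
Qed.

End metric_sequences.

(** * Cauchy sequences and the boundary of the uniformized space *)

Section uniformized_boundary.
Context {R : realType} {Z : metricType R} (z0 : Z) (eps : R).
Hypotheses (eps0 : 0 < eps) (geoZ : geodesic_space Z) (cZ : complete_space Z).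
Local Notation rho := (rho_eps z0 eps).
Local Notation D := (d_eps z0 eps).
Variable dP : is_distance D.
Local Notation U := (metric_of dP).
Implicit Types u : nat -> Z.

Lemma mdist_metric_of (x y : U) : mdist x y = D x y.
Proof. by []. Qed.

(** In terms of [d], the sequence leaves every bounded set. *)
Definition weight_vanishes u :=
  forall c : R, 0 < c -> exists N, forall n, (N <= n)%N -> rho (u n) < c.

Lemma rho_eps_ge_near x y : mdist x y <= 1 -> expR (- eps) * rho x <= rho y.
Proof.
move=> xy; rewrite expRN mulrC ler_pdivrMr ?expR_gt0// mulrC.
apply: le_trans (rho_eps_le_expR z0 _ eps0 x y) _.
by rewrite ler_pM2r ?rho_eps_gt0// ler_expR ler_piMr// ltW.
Qed.

Lemma weight_vanishes_far u x : weight_vanishes u ->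
  exists N, forall n, (N <= n)%N -> 1 <= mdist x (u n).
Proof.
move=> /(_ (expR (- eps) * rho x)); rewrite mulr_gt0 ?expR_gt0 ?rho_eps_gt0//.
move=> /(_ isT)[N hN]; exists N => n /hN h.
by rewrite leNgt; apply/negP => /ltW/rho_eps_ge_near; rewrite leNgt h.
Qed.

Lemma weight_vanishes_d_eps u x : weight_vanishes u ->
  exists N, forall n, (N <= n)%N -> expR (- eps) * rho x <= D x (u n).
Proof.
move=> /(weight_vanishes_far u x)[N hN]; exists N => n /hN xu.
apply: le_trans (d_eps_ge z0 eps eps0 geoZ x (u n)).
by rewrite min_l// mulr1.
Qed.

Lemma weight_vanishes_not_cvg u : weight_vanishes u -> ~ exists x : U, (u : nat -> U) @ \oo --> x.
Proof.
move=> hu [x /cvg_mdistP ux].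
have [N hN] := weight_vanishes_d_eps u x hu.
have [M hM] := ux (expR (- eps) * rho x) (mulr_gt0 (expR_gt0 _) (rho_eps_gt0 _ _ _)).
have := hN _ (leq_maxl N M); have := hM _ (leq_maxr N M).
by rewrite mdist_metric_of => /lt_le_trans h /h; rewrite ltxx.
Qed.

(** One late term of weight at least [c] bounds all late weights below by exp(-eps) c. Closeness for
    [d_eps] then implies closeness for [d], and completeness of [Z] gives the limit. *)
Lemma d_eps_cauchy_cvg u c : 0 < c -> cauchy ((u : nat -> U) @ \oo) ->
  (forall N, exists2 n, (N <= n)%N & c <= rho (u n)) -> exists x : U, (u : nat -> U) @ \oo --> x.
Proof.
move=> c0 /cauchy_mdistP cu hu.
have ec0 : 0 < expR (- eps) * c by rewrite mulr_gt0 ?expR_gt0.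
(* The factor [1] is the radius with which [d_eps_lt_mdist] is applied to get [rlow]. *)
have [N0 h0] := cu (expR (- eps) * c * 1) (mulr_gt0 ec0 ltr01).
have [n0 Nn0 cn0] := hu N0.
have far m n r : (N0 <= m)%N -> expR (- eps) * c <= rho (u m) -> 0 < r -> r <= 1 ->
    D (u m) (u n) < expR (- eps) * (expR (- eps) * c) * r -> mdist (u m) (u n) < r.
  move=> Nm cm r0 r1 h; apply: (d_eps_lt_mdist z0 _ eps0 geoZ) => //; first exact: ltW.
  by apply: lt_le_trans h _; rewrite ler_pM2r// ler_pM2l ?expR_gt0.
have rlow n : (N0 <= n)%N -> expR (- eps) * c <= rho (u n).
  move=> Nn; apply: (@le_trans _ _ (expR (- eps) * rho (u n0))).
    by rewrite ler_pM2l ?expR_gt0.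
  apply/rho_eps_ge_near/ltW/(d_eps_lt_mdist z0 _ eps0 geoZ) => //.
  apply: lt_le_trans (h0 _ _ Nn0 Nn) _.
  by rewrite !mulr1 ler_pM2l ?expR_gt0.
have [] := cZ u => //.
  apply/cauchy_mdistP => e e0.
  have r0 : 0 < Num.min e 1 by rewrite lt_min e0 ltr01.
  have [N1 h1] := cu _ (mulr_gt0 (mulr_gt0 (expR_gt0 (- eps)) ec0) r0).
  exists (maxn N0 N1) => m n; rewrite !geq_max => /andP[m0 m1] /andP[n0' n1].
  apply: (@lt_le_trans _ _ (Num.min e 1)); last by rewrite ge_min lexx.
  apply: far => //; [exact: rlow|by rewrite ge_min lexx orbT|exact: h1].
move=> x _ /cvg_mdistP ux; exists x; apply/cvg_mdistP => e e0.
have k0 : 0 < expR (eps * 1) * rho x by rewrite mulr_gt0 ?expR_gt0 ?rho_eps_gt0.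
have m0 : 0 < Num.min 1 (e / (expR (eps * 1) * rho x)) by rewrite lt_min ltr01 divr_gt0.
have [N hN] := ux _ m0.
exists N => n /hN; rewrite lt_min => /andP[/ltW d1]; rewrite ltr_pdivlMr// mulrC => de.
by apply: le_lt_trans de; exact: d_eps_le.
Qed.

Lemma d_eps_cauchy_not_cvg u : cauchy ((u : nat -> U) @ \oo) ->
  ~ (exists x : U, (u : nat -> U) @ \oo --> x) -> weight_vanishes u.
Proof.
move=> cu nu c c0; apply: contrapT => nN; apply: nu.
apply: (d_eps_cauchy_cvg u c c0 cu) => N; apply: contrapT => h.
apply: nN; exists N => n Nn; rewrite ltNge; apply/negP => cn.
by apply: h; exists n.
Qed.

(** Points of the chosen ball have [d]-distance less than 1 from [z], so weights are bounded below
    there and Cauchy sequences converge. *)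
Lemma metric_of_locally_complete : locally_complete U.
Proof.
move=> z; pose r := expR (- eps) * rho z * 1.
have r0 : 0 < r by rewrite /r mulr1 mulr_gt0 ?expR_gt0 ?rho_eps_gt0.
have r20 : 0 < r / 2 by rewrite divr_gt0.
exists [set y : U | mdist z y <= r / 2].
  by apply/nbhs_ballP; exists (r / 2) => //= y; rewrite ballEmdist => /ltW.
move=> u uN cu.
have [x ux] : exists x : U, u @ \oo --> x.
  apply: (d_eps_cauchy_cvg u (expR (- eps) * rho z)) => //.
    by rewrite mulr_gt0 ?expR_gt0 ?rho_eps_gt0.
  move=> N; exists N => //; apply/rho_eps_ge_near/ltW/(d_eps_lt_mdist z0 _ eps0 geoZ) => //.
  by apply: le_lt_trans (uN N) _; rewrite -/r; lra.
exists x => //=; apply/ler_addgt0Pr => e e0.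
move/cvg_mdistP: ux => /(_ e e0)[N hN].
have := metric_triangle z (u N) x; have := hN N (leqnn N); have := uN N => /=.
rewrite (metric_sym x); lra.
Qed.

Lemma rho_eps_le_boundary_dist z : ~ complete_space U ->
  expR (- eps) * rho z <= boundary_dist (z : U).
Proof.
move=> nc; apply: boundary_dist_ge => // u cu nu e e0.
have [N hN] := weight_vanishes_d_eps u z (d_eps_cauchy_not_cvg u cu nu).
by exists N => n /hN h; apply: le_trans h _; rewrite lerDl ltW.
Qed.

End uniformized_boundary.

(** * Transfer of boundary points and boundary distances *)

Section boundary_transfer.
Context {R : realType} {X Y : metricType R} (x0 : X) (y0 : Y) (eps tau : R).
Hypotheses (eps0 : 0 < eps) (geoX : geodesic_space X) (geoY : geodesic_space Y)
  (cX : complete_space X) (cY : complete_space Y).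
Variable Phi : Y -> X.
Hypotheses (tau0 : 0 <= tau)
  (Phi_le : forall y y', mdist (Phi y) (Phi y') <= mdist y y' + tau)
  (Phi_base : forall y, mdist y y0 <= mdist (Phi y) x0 + tau).
Local Notation rhoX := (rho_eps x0 eps).
Local Notation rhoY := (rho_eps y0 eps).
Local Notation DX := (d_eps x0 eps).
Local Notation DY := (d_eps y0 eps).
Variables (dX : is_distance DX) (dY : is_distance DY).
Local Notation UX := (metric_of dX).
Local Notation UY := (metric_of dY).
Local Notation C := (transfer_cst eps tau).

Lemma transfer_weight_vanishes (u : nat -> Y) :
  weight_vanishes y0 eps u -> weight_vanishes x0 eps (Phi \o u).
Proof.
move=> hu c c0; have [N hN] := hu (c / expR (eps * tau)) (divr_gt0 c0 (expR_gt0 _)).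
exists N => n /hN; rewrite ltr_pdivlMr ?expR_gt0// mulrC; apply: le_lt_trans.
exact: rho_eps_transfer.
Qed.

Lemma transfer_cauchy (u : nat -> Y) : weight_vanishes y0 eps u ->
  cauchy ((u : nat -> UY) @ \oo) -> cauchy ((Phi \o u : nat -> UX) @ \oo).
Proof.
move=> hu /cauchy_mdistP cu; apply/cauchy_mdistP => e e0.
have C0 : 0 < C by exact: transfer_cst_gt0.
have e20 : 0 < e / C / 2 by rewrite !divr_gt0.
have [N hN] := cu _ e20; have [M hM] := hu _ e20.
exists (maxn N M) => m n; rewrite !geq_max => /andP[Nm Mm] /andP[Nn _].
have h : DX (Phi (u m)) (Phi (u n)) <= C * (DY (u m) (u n) + rhoY (u m)) by exact: d_eps_transfer.
apply: (le_lt_trans h); rewrite mulrC -ltr_pdivlMr// [ltRHS]splitr ltrD//; [exact: hN|exact: hM].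
Qed.

Lemma transfer_not_complete : ~ complete_space UY -> ~ complete_space UX.
Proof.
move=> nc hc; apply: nc => u _ cu; apply: contrapT => nu.
have vu : weight_vanishes y0 eps u.
  apply: (d_eps_cauchy_not_cvg y0 eps eps0 geoY cY dY u cu) => -[x ux]; apply: nu; by exists x.
have := weight_vanishes_not_cvg x0 eps eps0 geoX dX _ (transfer_weight_vanishes u vu).
apply; have [//|x _ hx] := hc _ _ (transfer_cauchy u vu cu).
by exists x.
Qed.

(** The passage from [p] to [Phi z] costs a multiple of the weight at [z], which the distance from
    [z] to the boundary absorbs; this gives the first summand. The second one transfers distances
    from [z] to far points. *)
Lemma boundary_dist_transfer (k : R) (p : X) (z : Y) : ~ complete_space UY ->
  mdist p (Phi z) <= k ->
  boundary_dist (p : UX) <=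
    (k * expR (eps * (2 * k + tau)) * expR eps + C) * boundary_dist (z : UY).
Proof.
move=> nc pk; set A := k * _ * _.
have k0 : 0 <= k by apply: le_trans pk; exact: mdist_ge0.
have C0 : 0 < C by exact: transfer_cst_gt0.
have A0 : 0 <= A by rewrite !mulr_ge0 ?expR_ge0.
have AC0 : 0 < A + C by rewrite ltr_wpDl.
rewrite -ler_pdivrMl//; apply: boundary_dist_ge => // u cu nu e e0.
have vu := d_eps_cauchy_not_cvg y0 eps eps0 geoY cY dY u cu nu.
have vPu := transfer_weight_vanishes u vu.
have [N1 h1] := weight_vanishes_far y0 eps eps0 u z vu.
have [N2 h2] := weight_vanishes_d_eps y0 eps eps0 geoY u z vu.
have /cauchy_mdistP/(_ e e0)[N3 h3] := cu.
exists (maxn N1 (maxn N2 N3)) => m; rewrite !geq_max => /and3P[m1 m2 m3].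
rewrite ler_pdivrMl//.
apply: (@boundary_dist_le _ _ (Phi \o u : nat -> UX) p _ (maxn N1 (maxn N2 N3))).
- exact: transfer_cauchy.
- exact: weight_vanishes_not_cvg.
move=> n; rewrite !geq_max => /and3P[n1 n2 n3].
(* The index [m] is fixed while [n] grows; exchanging [u n] for [u m] costs [e]. *)
apply: (@le_trans _ _ ((A + C) * DY z (u n))); last first.
  rewrite ler_pM2l//; apply: le_trans (is_distance_triangle dY (u m) _ _) _.
  rewrite lerD//; apply/ltW/h3 => //.
apply: (@le_trans _ _ (DX p (Phi z) + DX (Phi z) (Phi (u n)))); first exact: is_distance_triangle.
rewrite mulrDl lerD//; last by apply: d_eps_transfer_far => //; exact: h1.
apply: le_trans (d_eps_le x0 eps eps0 geoX k _ _ pk) _.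
apply: (@le_trans _ _ (A * (expR (- eps) * rhoY z))); last by rewrite ler_wpM2l// h2.
rewrite /A -[X in _ <= X]mulrA [expR eps * _]mulrA -expRD subrr expR0 mul1r.
rewrite [k * _]mulrC -[X in _ <= X]mulrA.
rewrite [k * _]mulrC mulrA ler_pM ?mulr_ge0 ?expR_ge0 ?mdist_ge0 ?(ltW (rho_eps_gt0 _ _ _))//.
rewrite (_ : eps * (2 * k + tau) = eps * k + (eps * k + eps * tau)); last by ring.
rewrite expRD -mulrA ler_pM2l ?expR_gt0// expRD -mulrA.
apply: le_trans (rho_eps_le_expR _ _ eps0 _ (Phi z)) _.
apply: ler_pM; rewrite ?expR_ge0 ?(ltW (rho_eps_gt0 _ _ _))//.
  by rewrite ler_expR ler_pM2l.
exact: rho_eps_transfer.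
Qed.

End boundary_transfer.

(** * Uniform curves *)

Section chains.
Context {R : realType} {T : metricType R}.

Lemma mdist_within_continuous (g : R -> T) a b (c : R) (x : T) : a <= c ->
  {within `[a, b], continuous g} -> {within `[c, b], continuous (fun s => mdist x (g s))}.
Proof.
move=> ac /within_continuous_mdistP cg.
apply/(within_continuous_mdistP ((fun s => mdist x (g s)) : R -> R^o)) => t.
rewrite in_itv/= => /andP[ct tb] e e0.
have [|r r0 hr] := cg t _ e e0; first by rewrite in_itv/= tb (le_trans ac).
exists r => // s; rewrite in_itv/= => /andP[cs sb] ts.
rewrite {1}/mdist/=; apply: le_lt_trans (mdist_diff_le _ _ _ _) _.
rewrite mdistxx add0r metric_sym hr// in_itv/= sb andbT; exact: le_trans ac cs.
Qed.

(** Greedy subdivision, stopped once the end point is within reach. Each full step uses up length at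
    least [eta], so the finite length bounds the number of steps. *)
Lemma curve_chain (g : R -> T) a b (w : R -> R) (eta : R) : a <= b -> 0 < eta ->
  {within `[a, b], continuous g} -> (curve_length g a b < +oo)%E ->
  (forall t, a <= t -> t <= b -> eta <= w t) ->
  exists (n : nat) (t : nat -> R), [/\ t 0%N = a, t n.+1 = b,
    forall j, (j <= n)%N -> [/\ a <= t j, t j <= t j.+1 & t j.+1 <= b],
    forall j, (j <= n)%N -> mdist (g (t j)) (g (t j.+1)) <= w (t j) &
    forall j, (j < n)%N -> mdist (g (t j)) (g (t j.+1)) = w (t j)].
Proof.
move=> ab eta0 cg fg hw.
have H N c : a <= c -> c <= b -> (curve_length g c b <= (N%:R * eta)%:E)%E ->
  exists (n : nat) (t : nat -> R), [/\ t 0%N = c, t n.+1 = b,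
    forall j, (j <= n)%N -> [/\ a <= t j, t j <= t j.+1 & t j.+1 <= b],
    forall j, (j <= n)%N -> mdist (g (t j)) (g (t j.+1)) <= w (t j) &
    forall j, (j < n)%N -> mdist (g (t j)) (g (t j.+1)) = w (t j)].
  elim: N c => [|N IH] c ac cb cN; have [small|big] := leP (mdist (g c) (g b)) (w c).
  - by exists 0%N, (fun j => if j is 0%N then c else b); split => // -[|].
  - have := le_trans (mdist_le_curve_length g _ _ cb) cN.
    have := hw c ac cb; rewrite mul0r lee_fin; lra.
  - by exists 0%N, (fun j => if j is 0%N then c else b); split => // -[|].
  (* The next division point is at distance exactly [w c] from the current one. *)
  have [|c' + hc'] := IVT cb (mdist_within_continuous g a b c (g c) ac cg) (v := w c).
    rewrite mdistxx min_l ?mdist_ge0// max_r ?mdist_ge0// (ltW big) andbT.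
    exact: le_trans (ltW eta0) (hw c ac cb).
  rewrite in_itv/= => /andP[cc' c'b]; have ac' := le_trans ac cc'.
  have [|n [t [t0 tn ht hm he]]] := IH c' ac' c'b.
    have := curve_length_split g _ _ _ cc' c'b; have := mdist_le_curve_length g _ _ cc'.
    rewrite hc' -(fineK (curve_length_fin g a b fg c c' ac cc' c'b)).
    rewrite -(fineK (curve_length_fin g a b fg c' b ac' c'b (lexx _))).
    rewrite lee_fin => h1 h2; move: cN; rewrite h2 -EFinD !lee_fin -natr1 mulrDl mul1r.
    have := hw c ac cb; lra.
  exists n.+1, (fun j => if j is j'.+1 then t j' else c); split => //.
  - by move=> [_|j]; [rewrite t0|exact: ht].
  - by move=> [_|j]; [rewrite t0 hc'|exact: hm].
  - by move=> [_|j]; [rewrite t0 hc'|exact: he].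
have [t0 tN] : exists N, (curve_length g a b <= (N%:R * eta)%:E)%E.
  have L0 : 0 <= fine (curve_length g a b) / eta.
    by rewrite divr_ge0 ?(ltW eta0)// fine_ge0// curve_length_ge0.
  exists (Num.bound (fine (curve_length g a b) / eta)).
  rewrite -(fineK (curve_length_fin g a b fg a b (lexx _) ab (lexx _))) lee_fin.
  by rewrite -ler_pdivrMr// ltW// archi_boundP.
exact: H tN.
Qed.

Lemma sum_mdist_le_curve_length (g : R -> T) (t : nat -> R) i k : (i <= k)%N ->
  (forall j, (i <= j)%N -> (j < k)%N -> t j <= t j.+1) ->
  ((\sum_(i <= j < k) mdist (g (t j)) (g (t j.+1)))%:E <= curve_length g (t i) (t k))%E
  /\ t i <= t k.
Proof.
elim: k => [|k IH].
  by rewrite leqn0 => /eqP -> _; rewrite big_nil curve_lengthxx.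
rewrite leq_eqVlt => /predU1P[<- _|]; first by rewrite big_geq// curve_lengthxx.
rewrite ltnS => ik ht; have [|h1 h2] := IH ik; first by move=> j ij jk; rewrite ht// ltnW.
have h3 : t k <= t k.+1 by exact: ht.
split; last exact: le_trans h3.
rewrite big_nat_recr//= EFinD; apply: le_trans (curve_length_superadd g _ _ _ h2 h3).
by rewrite leeD// mdist_le_curve_length.
Qed.

(** Repeated concatenation; [Q] keeps for each point what is known about the piece it comes from. *)
Lemma speed_le1_chain (w : nat -> T) (m : nat -> R) (Q : nat -> T -> Prop) n :
  (forall j, 0 <= m j) ->
  (forall j, (j <= n)%N -> exists g : R -> T, [/\ g 0 = w j, g (m j) = w j.+1,
     speed_le1 g (m j) & forall s, 0 <= s -> s <= m j -> Q j (g s)]) ->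
  exists g : R -> T, [/\ g 0 = w 0%N, g (\sum_(0 <= j < n.+1) m j) = w n.+1,
    speed_le1 g (\sum_(0 <= j < n.+1) m j) &
    forall t, 0 <= t -> t <= \sum_(0 <= j < n.+1) m j -> exists i, [/\ (i <= n)%N,
      \sum_(0 <= j < i) m j <= t, t <= \sum_(0 <= j < i.+1) m j & Q i (g t)]].
Proof.
move=> m0; elim: n => [|n IH] hs.
  have [g [g0 g1 gl gQ]] := hs 0%N (leqnn _); rewrite big_nat1; exists g; split => // t t0 tm.
  by exists 0%N; rewrite big_geq// big_nat1; split => //; exact: gQ.
have [|g [g0 gL gl gQ]] := IH; first by move=> j jn; apply: hs; exact: ltnW.
have [h [h0 hm hl hQ]] := hs n.+1 (leqnn _).
have -> : \sum_(0 <= j < n.+2) m j = \sum_(0 <= j < n.+1) m j + m n.+1.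
  by rewrite big_nat_recr.
set S := \sum_(0 <= j < n.+1) m j in g0 gL gl gQ *.
have S0 : 0 <= S by rewrite sumr_ge0.
exists (fun t => if t <= S then g t else h (t - S)); split.
- by rewrite S0.
- have [|_] := leP (S + m n.+1) S; last by rewrite [S + _]addrC addrK.
  rewrite gerDl => mn; have mn0 : m n.+1 = 0 by apply/eqP; rewrite eq_le mn m0.
  by rewrite mn0 addr0 gL -hm mn0 h0.
- by apply: speed_le1_concat => //; rewrite gL h0.
move=> t t0 tS; have [ts|ts] := leP t S.
  by have [i [iN h1 h2 h3]] := gQ t t0 ts; exists i; split => //; exact: ltnW.
exists n.+1; split => //; first exact: ltW.
  by rewrite big_nat_recr.
by apply: hQ; lra.
Qed.

(* The conditions of [uniform_domain], with [lambda] moved to the right-hand side. *)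
Definition uniform_path (lambda : R) (g : R -> T) (a b : R) (x y : T) :=
  [/\ rectifiable_path g a b x y,
      (curve_length g a b <= (lambda * mdist x y)%:E)%E &
      forall t, t \in `[a, b] ->
        (Order.min (curve_length g a t) (curve_length g t b)
         <= (lambda * boundary_dist (g t))%:E)%E].

Lemma boundary_dist_ge0 (z : T) : 0 <= boundary_dist z.
Proof.
rewrite /boundary_dist; set A := [set _ | _ in _].
have [->|A0] := eqVneq A set0; first by rewrite inf0.
by apply: lb_le_inf; [exact/set0P|move=> _ [p _ <-]; exact: mdist_ge0].
Qed.

Lemma uniform_path_le lambda lambda' g a b x y : lambda <= lambda' ->
  uniform_path lambda g a b x y -> uniform_path lambda' g a b x y.
Proof.
move=> ll [rp len hb]; split => // [|t tab].
  by apply: le_trans len _; rewrite lee_fin ler_wpM2r// mdist_ge0.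
by apply: le_trans (hb t tab) _; rewrite lee_fin ler_wpM2r// boundary_dist_ge0.
Qed.

End chains.

(** * Comparison of sums along a chain *)

Section chain_sums.
Context {R : realType} (m d : nat -> R) (n : nat) (C q : R).
Hypotheses (q0 : 0 <= q) (m0 : forall j, 0 <= m j)
  (md : forall j, (j < n)%N -> m j * (1 + q) <= C * d j)
  (mq : forall j, (j < n)%N -> m j.+1 <= q * m j).

Lemma chain_sum_head i : (i <= n)%N ->
  \sum_(0 <= j < i) m j <= C * \sum_(0 <= j < i) d j.
Proof.
move=> i_n; rewrite mulr_sumr !big_nat ler_sum// => j /= ji.
by apply: le_trans (md j (leq_trans ji i_n)); rewrite ler_peMr// lerDl.
Qed.

(** The factor [1 + q] in [md] pays for each term and for a possible successor. Only the last term
    uses the second share, and its predecessor is in the sum because [i < n]. *)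
Lemma chain_sum_tail i : (i < n)%N ->
  \sum_(i <= j < n.+1) m j <= C * \sum_(i <= j < n) d j.
Proof.
move=> i_n; rewrite big_nat_recr ?(ltnW i_n)//=.
apply: (@le_trans _ _ ((\sum_(i <= j < n) m j) * (1 + q))); last first.
  rewrite mulr_sumr mulr_suml !big_nat ler_sum// => j /andP[_]; exact: md.
rewrite mulrDr mulr1 lerD2l mulrC.
case: n i_n mq => // n' i_n mq'; apply: le_trans (mq' n' (ltnSn _)) _.
by rewrite ler_wpM2l// big_nat_recr//= lerDr sumr_ge0.
Qed.

(** For [i = n] the sum of the [d j] is empty, whence the additional [m i]. *)
Lemma chain_sum_tail_last i : (i <= n)%N ->
  \sum_(i <= j < n.+1) m j <= C * \sum_(i <= j < n) d j + m i.
Proof.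
rewrite leq_eqVlt => /predU1P[->|i_n].
  by rewrite big_nat1 big_geq// mulr0 add0r.
by apply: le_trans (chain_sum_tail i i_n) _; rewrite lerDl.
Qed.

End chain_sums.

(** * Construction of uniform curves in [Y] *)

Section uniform_curves.
Context {R : realType} {X Y : metricType R} (y0 : Y) (eps tau : R).
Hypotheses (eps0 : 0 < eps) (geoX : geodesic_space X) (geoY : geodesic_space Y)
  (cX : complete_space X) (cY : complete_space Y).
Variable Phi : Y -> X.
Hypotheses (tau0 : 0 <= tau) (rPhi : rough_isometry tau Phi).
Local Notation rhoX := (rho_eps (Phi y0) eps).
Local Notation rhoY := (rho_eps y0 eps).
Local Notation DX := (d_eps (Phi y0) eps).
Local Notation DY := (d_eps y0 eps).
Variables (dX : is_distance DX) (dY : is_distance DY).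
Local Notation UX := (metric_of dX).
Local Notation UY := (metric_of dY).

Let Phi_le y y' : mdist (Phi y) (Phi y') <= mdist y y' + tau.
Proof. by have /andP[] := rPhi.1 y y'. Qed.

Let Phi_ge y y' : mdist y y' <= mdist (Phi y) (Phi y') + tau.
Proof. by have /andP[] := rPhi.1 y y'; rewrite lerBlDr. Qed.

Let rho_pos y : 0 < rhoY y. Proof. exact: rho_eps_gt0. Qed.

(** The transfer is applied to a rough inverse [Psi] of [Phi]. Its error [3 * tau] consists of the
    error of [Phi] and of one [tau] at each of the two points. *)
Lemma rough_isometry_not_complete : ~ complete_space UX -> ~ complete_space UY.
Proof.
have [Psi hPsi] := choice rPhi.2.
apply: (@transfer_not_complete R Y X y0 (Phi y0) eps (3 * tau) eps0 geoY geoX cX Psi) => //.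
- by rewrite mulr_ge0.
- move=> x x'; have := Phi_ge (Psi x) (Psi x').
  have := metric_triangle (Phi (Psi x)) x (Phi (Psi x')).
  have := metric_triangle x x' (Phi (Psi x')); have := hPsi x; have := hPsi x'.
  rewrite (metric_sym (Phi (Psi x)) x); lra.
- move=> x; have := tau0; have := hPsi x; have := Phi_le (Psi x) y0.
  have := metric_triangle x (Phi (Psi x)) (Phi y0); lra.
Qed.

Lemma geodesic_d_eps_lipschitz K g y y' : geodesic_path g y y' -> mdist y y' <= K ->
  forall s t, 0 <= s -> s <= t -> t <= mdist y y' ->
  [/\ mdist (g s) y <= K & DY (g s) (g t) <= expR (eps * (2 * K)) * rhoY y * (t - s)].
Proof.
move=> gg yK s t s0 st tL; have [g0 _ _] := gg.
have sp := geodesic_speed_le1 _ _ _ gg; have sL := le_trans st tL.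
have sK : mdist (g s) y <= K.
  rewrite metric_sym -g0; apply: le_trans (sp 0 s (lexx _) s0 sL) _.
  by rewrite subr0 (le_trans sL).
have stK : mdist (g s) (g t) <= K.
  by apply: le_trans (sp s t s0 st tL) _; lra.
split=> //; apply: le_trans (d_eps_le y0 eps eps0 geoY K _ _ stK) _.
(* One factor comes from [d_eps_le], the other from comparing the weights at [g s] and [y]. *)
have -> : eps * (2 * K) = eps * K + eps * K by ring.
rewrite expRD; apply: ler_pM; rewrite ?mulr_ge0 ?expR_ge0 ?mdist_ge0 ?(ltW (rho_pos _))//.
  rewrite -mulrA ler_pM2l ?expR_gt0//.
  apply: le_trans (rho_eps_le_expR y0 _ eps0 _ y) _.
  by rewrite ler_pM2r// ler_expR ler_pM2l.
exact: sp.
Qed.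

(** The weight is continuous for [d_eps] and attains its minimum on the curve. The bound supplies
    the [eta] of [curve_chain]. *)
Lemma rho_eps_curve_lower_bound (g : R -> UX) (a b : R) : a <= b ->
  {within `[a, b], continuous g} ->
  exists2 eta : R, 0 < eta & forall t, a <= t -> t <= b -> eta <= rhoX (g t).
Proof.
move=> ab /within_continuous_mdistP cg.
have [|c _ hc] := @EVT_min R (fun t => rhoX (g t)) a b ab; last first.
  exists (rhoX (g c)); first exact: rho_eps_gt0.
  by move=> t at_ tb; apply: hc; rewrite in_itv/= at_.
apply/(within_continuous_mdistP ((fun t => rhoX (g t)) : R -> R^o)) => t tab e e0.
have r0 : 0 < Num.min 1 (e / eps) by rewrite lt_min ltr01 divr_gt0.
have [|r rp hr] := cg t tab (expR (- eps) * rhoX (g t) * Num.min 1 (e / eps)).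
  by rewrite !mulr_gt0 ?expR_gt0 ?rho_eps_gt0.
exists r => // s sab /(hr s sab).
move=> /(d_eps_lt_mdist (Phi y0) eps eps0 geoX (g t) (g s) _ (ltW r0)).
rewrite ge_min lexx => /(_ isT); rewrite lt_min => /andP[_].
rewrite ltr_pdivlMr// mulrC => h; rewrite /mdist/= distrC.
exact: le_lt_trans (rho_eps_lipschitz _ _ eps0 _ _) h.
Qed.

Hypothesis ncY : ~ complete_space UY.

Let rho_le_boundary z : rhoY z <= expR eps * boundary_dist (z : UY).
Proof.
rewrite -ler_pdivrMl ?expR_gt0// -expRN.
exact: rho_eps_le_boundary_dist.
Qed.

(** Bound for a step in [Y]: less than 1 in [X], [tau] at each end for the rough inverse, and [tau]
    for [Phi] itself. *)
Definition step_bound := 1 + 3 * tau.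
Local Notation K := step_bound.
(** Compares the [d_eps]-length of a segment with the boundary distance of one of its points: 2 K of
    the exponent bounds the length, K changes the point, and the last factor passes from weight to
    boundary distance. *)
Definition near_cst := K * expR (eps * (3 * K)) * expR eps.
(** Ratio of a new piece to a step of the given curve. The factors exp(eps tau) compare the weights
    in [Y] and [X], [2 * expR eps] inverts the step size, and the last factor is the [1 + q] of the
    chain sums. *)
Definition chain_cst :=
  expR (eps * (2 * K)) * (expR (eps * tau) * expR (eps * tau)) * K * (2 * expR eps)
  * (1 + expR (eps * K)).
(** The constant of [boundary_dist_transfer] for k = K + 2 tau, which bounds the distance from the
    image of a point of the new curve to the division point of its piece. *)
Definition shadow_cst := (K + 2 * tau) * expR (eps * (2 * (K + 2 * tau) + tau)) * expR eps
  + transfer_cst eps tau.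

Let K1 : 1 <= K. Proof. by rewrite /step_bound lerDl mulr_ge0. Qed.
Let K0 : 0 < K. Proof. exact: lt_le_trans K1. Qed.

(* The geodesic is slowed down so that it has speed at most 1 for [DY]; this
   also covers the constant geodesic, where the parameter interval is a point. *)
Lemma geodesic_segment (y y' : Y) (k : R) : mdist y y' <= K -> mdist y y' <= k ->
  let M := expR (eps * (2 * K)) * rhoY y in
  exists g : R -> UY, [/\ g 0 = y, g (M * k) = y', speed_le1 g (M * k) &
    forall s, 0 <= s -> s <= M * k -> mdist (g s : Y) y <= K].
Proof.
move=> yK yk M; have M0 : 0 < M by rewrite mulr_gt0 ?expR_gt0.
have [G gG] := geoY y y'; have [G0 G1 _] := gG.
have d0 : 0 <= mdist y y' by exact: mdist_ge0.
pose q := mdist y y' / k.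
have qk : q * k = mdist y y'.
  have [k0|k0] := eqVneq k 0; last by rewrite /q divfK.
  by apply/eqP; rewrite k0 mulr0 eq_le d0 -k0.
have k0 : 0 <= k by exact: le_trans yk.
have q0 : 0 <= q by rewrite divr_ge0.
have q1 : q <= 1.
  move: k0; rewrite le_eqVlt => /predU1P[k0|k0]; first by rewrite /q -k0 invr0 mulr0.
  by rewrite ler_pdivrMr// mul1r.
have par s t : 0 <= s -> s <= t -> t <= M * k ->
    [/\ 0 <= s / M * q, s / M * q <= t / M * q & t / M * q <= mdist y y'].
  move=> s0 st tL; split.
  - by rewrite mulr_ge0 ?divr_ge0// ltW.
  - by rewrite ler_wpM2r// ler_pM2r ?invr_gt0.
  - by rewrite -qk [q * k]mulrC ler_wpM2r// ler_pdivrMr// mulrC.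
exists (fun s => G (s / M * q)); split.
- by rewrite !mul0r.
- by rewrite [M * k]mulrC mulfK ?gt_eqF// mulrC qk.
- move=> s t s0 st tL; have [h1 h2 h3] := par s t s0 st tL.
  have [_] := geodesic_d_eps_lipschitz _ _ _ _ gG yK _ _ h1 h2 h3.
  move=> /le_trans; apply; rewrite -/M -mulrBl -mulrBl mulrA mulrC [M * _]mulrC divfK ?gt_eqF//.
  by rewrite ler_piMl// subr_ge0.
move=> s s0 sL; have [h1 h2 h3] := par s s s0 (lexx _) sL.
by have [] := geodesic_d_eps_lipschitz _ _ _ _ gG yK _ _ h1 h2 h3.
Qed.

Let segment_bound (y z : Y) : mdist z y <= K ->
  expR (eps * (2 * K)) * rhoY y * K <= near_cst * boundary_dist (z : UY).
Proof.
move=> zy; rewrite /near_cst (_ : eps * (3 * K) = eps * (2 * K) + eps * K); last by ring.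
rewrite expRD [X in X <= _]mulrC -!mulrA ler_pM2l// ler_pM2l ?expR_gt0//.
apply: le_trans (rho_eps_le_expR y0 _ eps0 y z) _.
apply: ler_pM; rewrite ?expR_ge0 ?(ltW (rho_pos _))//.
by rewrite ler_expR ler_pM2l// metric_sym.
Qed.

Lemma uniform_path_near (y y' : Y) : mdist y y' <= K ->
  exists (g : R -> UY) (a b : R), uniform_path near_cst g a b y y'.
Proof.
move=> yK; have [g [g0 g1 gl gK]] := geodesic_segment y y' _ yK (lexx _).
set M := expR _ * _ in g1 gl gK; have M0 : 0 < M by rewrite mulr_gt0 ?expR_gt0.
have L0 : 0 <= M * mdist y y' by rewrite mulr_ge0 ?mdist_ge0 ?ltW.
exists g, 0, (M * mdist y y'); split.
- rewrite -{2}g0 -{2}g1; exact: speed_le1_rectifiable.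
- apply: le_trans (speed_le1_curve_length _ _ _ _ gl (lexx _) L0 (lexx _)) _.
  rewrite lee_fin subr0.
  (* Since [mdist y y' <= K] and [1 <= K], the minimum in [d_eps_ge] is at least d(y,y') / K. *)
  have : expR (- eps) * rhoY y * (mdist y y' / K) <= DY y y'.
    apply: le_trans (d_eps_ge y0 eps eps0 geoY y y').
    rewrite ler_wpM2l ?mulr_ge0 ?expR_ge0 ?(ltW (rho_pos _))// le_min.
    by rewrite !ler_pdivrMr// mul1r yK ler_peMr// mdist_ge0.
  move=> h; have nc0 : 0 < near_cst by rewrite !mulr_gt0 ?expR_gt0.
  apply: le_trans (_ : _ <= near_cst * (expR (- eps) * rhoY y * (mdist y y' / K))) _; last first.
    by rewrite ler_pM2l.
  have -> : near_cst * (expR (- eps) * rhoY y * (mdist y y' / K)) =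
      expR (eps * (3 * K)) * rhoY y * mdist y y'.
    rewrite /near_cst expRN; field.
    by rewrite (gt_eqF K0) (gt_eqF (expR_gt0 _)).
  rewrite ler_wpM2r ?mdist_ge0// ler_pM2r// ler_expR ler_pM2l// ler_pM2r//.
  by rewrite ler_nat.
move=> t; rewrite in_itv/= => /andP[t0 tL].
rewrite ge_min; apply/orP; left.
apply: le_trans (speed_le1_curve_length _ _ _ _ gl (lexx _) t0 tL) _.
rewrite lee_fin subr0; apply: (le_trans tL).
apply: le_trans (segment_bound y (g t) (gK t t0 tL)).
by rewrite ler_pM2l.
Qed.

Let rho_le_Phi y : rhoY y <= expR (eps * tau) * rhoX (Phi y).
Proof.
rewrite -expRD ler_expR.
have : eps * mdist (Phi y) (Phi y0) <= eps * (mdist y y0 + tau) by rewrite ler_pM2l.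
lra.
Qed.

(* A step has [d_eps]-length [exp(-eps) rho / 2]; for this value [d_eps_ge]
   forces its length in [X] to be less than 1. *)
Let step_cost (x : X) (y : Y) : mdist x (Phi y) <= tau ->
  expR (eps * (2 * K)) * rhoY y * K * (1 + expR (eps * K)) <=
  chain_cst * (expR (- eps) / 2 * rhoX x).
Proof.
move=> xy; have -> : chain_cst * (expR (- eps) / 2 * rhoX x) = expR (eps * (2 * K)) *
    (expR (eps * tau) * (expR (eps * tau) * rhoX x)) * K * (1 + expR (eps * K)).
  by rewrite /chain_cst expRN; field; rewrite gt_eqF ?expR_gt0.
rewrite ler_pM2r ?addr_gt0 ?expR_gt0// ler_pM2r// ler_pM2l ?expR_gt0//.
apply: le_trans (rho_le_Phi y) _; rewrite ler_pM2l ?expR_gt0//.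
apply: le_trans (rho_eps_le_expR _ _ eps0 _ x) _.
by rewrite ler_pM2r ?rho_eps_gt0// ler_expR ler_pM2l// metric_sym.
Qed.

Lemma uniform_path_far (y y' : Y) lambda (g : R -> UX) a b : 1 <= lambda ->
  1 + tau < mdist y y' -> uniform_path lambda g a b (Phi y) (Phi y') ->
  exists (h : R -> UY) (c d : R), uniform_path
    (near_cst + chain_cst * lambda * (transfer_cst eps tau + shadow_cst)) h c d y y'.
Proof.
move=> l1 yy [rp glen hb]; have [ab cg ga gb fg] := rp.
have [eta eta0 heta] := rho_eps_curve_lower_bound g a b ab cg.
have c0 : 0 < expR (- eps) / 2 by rewrite divr_gt0 ?expR_gt0.
have weta s : a <= s -> s <= b -> expR (- eps) / 2 * eta <= expR (- eps) / 2 * rhoX (g s).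
  by move=> as_ sb; rewrite ler_pM2l// heta.
have [n [t [t0 tn ht hm he]]] := curve_chain g a b _ _ ab (mulr_gt0 c0 eta0) cg fg weta.
have [Psi hPsi] := choice rPhi.2.
(* The end points are kept exactly; only interior division points pass through the rough inverse. *)
pose w j := if j is 0%N then y else if j == n.+1 then y' else Psi (g (t j)).
have w0 : w 0%N = y by [].
have wn : w n.+1 = y' by rewrite /w eqxx.
have gw j : mdist (g (t j) : X) (Phi (w j)) <= tau.
  case: j => [|j]; first by rewrite t0 ga /w mdistxx.
  by rewrite /w; case: eqP => [->|_]; [rewrite tn gb mdistxx|exact: hPsi].
have gg j : (j <= n)%N -> mdist (g (t j) : X) (g (t j.+1)) < 1.
  move=> jn; apply: (d_eps_lt_mdist (Phi y0) eps eps0 geoX) => //.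
  apply: le_lt_trans (hm j jn) _; rewrite mulr1 ltr_pM2r ?rho_eps_gt0//.
  by rewrite ltr_pdivrMr// ltr_pMr ?expR_gt0// ltr1n.
(* A single step would put [Phi y] and [Phi y'] at distance less than 1. Hence the last piece has a
   predecessor. *)
have n0 : (0 < n)%N.
  rewrite lt0n; apply/eqP => nE; move: tn gg; rewrite nE => tn /(_ 0%N isT).
  rewrite t0 tn ga gb; have := Phi_ge y y'; move: yy; lra.
have ww j : (j <= n)%N -> mdist (w j) (w j.+1) <= K.
  move=> jn; apply: le_trans (Phi_ge _ _) _.
  have h1 := metric_triangle (Phi (w j)) (g (t j) : X) (Phi (w j.+1)).
  have h2 := metric_triangle (g (t j) : X) (g (t j.+1)) (Phi (w j.+1)).
  have h3 := gw j; have h4 := gw j.+1; have h5 := gg j jn.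
  rewrite (metric_sym (Phi (w j)) (g (t j) : X)) in h1.
  move: h1 h2 h3 h4 h5; rewrite /step_bound; lra.
(* The duration uses [K] in place of the actual distance, so that it depends only on the weight at
   [w j] and consecutive durations are comparable. *)
pose m j := expR (eps * (2 * K)) * rhoY (w j) * K.
have m0 j : 0 <= m j by rewrite !mulr_ge0 ?expR_ge0 ?(ltW (rho_pos _)) ?(ltW K0).
have md j : (j < n)%N -> m j * (1 + expR (eps * K)) <= chain_cst * DX (g (t j)) (g (t j.+1)).
  by move=> jn; rewrite (_ : DX _ _ = expR (- eps) / 2 * rhoX (g (t j))) ?step_cost ?gw// -he.
have mq j : (j < n)%N -> m j.+1 <= expR (eps * K) * m j.
  move=> jn; have -> : expR (eps * K) * m j =
      expR (eps * (2 * K)) * (expR (eps * K) * rhoY (w j)) * K by rewrite /m; ring.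
  rewrite ler_pM2r// ler_pM2l ?expR_gt0//.
  apply: le_trans (rho_eps_le_expR y0 _ eps0 _ (w j)) _.
  by rewrite ler_pM2r// ler_expR ler_pM2l// metric_sym ww// ltnW.
have [h [h0 hL hl hQ]] := speed_le1_chain (T := UY) w m
  (fun j (z : UY) => mdist (z : Y) (w j) <= K) n m0
  (fun j jn => geodesic_segment (w j) (w j.+1) K (ww j jn) (ww j jn)).
set L := \sum_(0 <= j < n.+1) m j in hL hl hQ.
have L0 : 0 <= L by rewrite sumr_ge0.
have e0 : 0 <= expR (eps * K) by exact: expR_ge0.
have nc0 : 0 < near_cst by rewrite !mulr_gt0 ?expR_gt0.
have cc0 : 0 < chain_cst.
  by rewrite !mulr_gt0 ?expR_gt0 ?(addr_gt0 ltr01 (expR_gt0 _)).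
have tc0 : 0 < transfer_cst eps tau by exact: transfer_cst_gt0.
have sc0 : 0 < shadow_cst.
  rewrite /shadow_cst ltr_wpDl// !mulr_ge0 ?expR_ge0// addr_ge0 ?(ltW K0)//.
  by rewrite mulr_ge0.
have l0 : 0 < lambda by apply: lt_le_trans l1.
have sumE i k : (i <= k)%N -> (k <= n)%N ->
    ((\sum_(i <= j < k) DX (g (t j)) (g (t j.+1)))%:E <= curve_length g (t i) (t k))%E
    /\ t i <= t k.
  move=> ik kn; apply: sum_mdist_le_curve_length => // j _ jk.
  by have [] := ht j (ltnW (leq_trans jk kn)).
have tab i : (i <= n)%N -> a <= t i <= b.
  by move=> i_n; have [h1 h2 h3] := ht i i_n; rewrite h1 (le_trans h2).
have far : DX (Phi y) (Phi y') <= transfer_cst eps tau * DY y y'.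
  apply: d_eps_transfer_far => //.
  by have := tau0; move: yy; lra.
exists h, 0, L; split.
- by rewrite -w0 -h0 -wn -hL; exact: speed_le1_rectifiable.
- apply: le_trans (speed_le1_curve_length _ _ _ _ hl (lexx _) L0 (lexx _)) _.
  rewrite lee_fin subr0.
  apply: (le_trans (chain_sum_tail m _ n _ _ e0 m0 md mq 0%N n0)).
  apply: (@le_trans _ _ (chain_cst * (lambda * (transfer_cst eps tau * DY y y')))).
    rewrite ler_pM2l//; apply: (@le_trans _ _ (lambda * DX (Phi y) (Phi y'))).
      rewrite -lee_fin; apply: le_trans glen; have [h1 _] := sumE 0%N n (leq0n _) (leqnn _).
      apply: le_trans h1 _; rewrite t0; have /andP[h2 h3] := tab n (leqnn _).
      exact: curve_length_monor.
    by rewrite ler_pM2l.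
  have -> : chain_cst * (lambda * (transfer_cst eps tau * DY y y')) =
    chain_cst * lambda * transfer_cst eps tau * DY y y' by ring.
  rewrite -[mdist _ _]/(DY y y') ler_wpM2r ?d_eps_ge0// mulrDr addrCA lerDl.
  exact: addr_ge0 (ltW nc0) (mulr_ge0 (mulr_ge0 (ltW cc0) (ltW l0)) (ltW sc0)).
move=> s; rewrite in_itv/= => /andP[s0 sL]; have [i [i_n h1 h2 h3]] := hQ s s0 sL.
have Kw : mdist (h s : Y) (w i) <= K by [].
have mi : m i <= near_cst * boundary_dist (h s) by exact: segment_bound.
have bt : boundary_dist (g (t i)) <= shadow_cst * boundary_dist (h s).
  apply: boundary_dist_transfer => //.
  have := metric_triangle (g (t i) : X) (Phi (w i)) (Phi (h s)).
  have := gw i; have := Phi_le (w i) (h s); rewrite (metric_sym (w i)).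
  by move: Kw; lra.
have key (A : \bar R) d : (d%:E <= A)%E -> (A <= (lambda * boundary_dist (g (t i)))%:E)%E ->
    chain_cst * d + m i <= (near_cst + chain_cst * lambda * (transfer_cst eps tau + shadow_cst))
      * boundary_dist (h s).
  move=> dA /(le_trans dA); rewrite lee_fin => dl.
  have -> : (near_cst + chain_cst * lambda * (transfer_cst eps tau + shadow_cst)) *
      boundary_dist (h s) = near_cst * boundary_dist (h s) +
      chain_cst * (lambda * ((transfer_cst eps tau + shadow_cst) * boundary_dist (h s))).
    by ring.
  rewrite addrC lerD// ler_pM2l//; apply: le_trans dl _.
  rewrite ler_pM2l//; apply: le_trans bt _.
  by rewrite ler_wpM2r ?boundary_dist_ge0// lerDr ltW.
(* The shorter side of the given curve at [t i] decides on which side of [s] the new curve is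
   measured. *)
have := hb (t i); rewrite in_itv/= tab// => /(_ isT); rewrite ge_min => /orP[hA|hA].
- rewrite ge_min; apply/orP; left.
  apply: le_trans (speed_le1_curve_length _ _ _ _ hl (lexx _) s0 sL) _.
  rewrite lee_fin subr0; apply: (le_trans h2); rewrite big_nat_recr//=.
  have [h4 _] := sumE 0%N i (leq0n _) i_n; rewrite t0 in h4.
  apply: le_trans _ (key _ _ h4 hA); rewrite lerD2r.
  exact: (chain_sum_head m _ n _ _ e0 m0 md).
- rewrite ge_min; apply/orP; right.
  apply: le_trans (speed_le1_curve_length _ _ _ _ hl s0 sL (lexx _)) _.
  have [h4 h5] := sumE i n i_n (leqnn _); have /andP[_ h6] := tab n (leqnn _).
  rewrite lee_fin; apply: le_trans _ (key _ _ (le_trans h4 (curve_length_monor g _ _ _ h5 h6)) hA).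
  apply: le_trans _ (chain_sum_tail_last m _ n _ _ e0 m0 md mq i i_n).
  rewrite lerBlDr /L (big_cat_nat (n := i))//= ?(leqW i_n)//.
  by rewrite addrC lerD2l.
Qed.

End uniform_curves.

Theorem theorem3p8 (R : realType) :
  exists Lambda : R -> R -> R -> R,
  forall (X Y : metricType R) (tau : R) (Phi : Y -> X) (y0 : Y)
         (eps lambda : R),
    gromov_hyperbolic X -> gromov_hyperbolic Y ->
    0 <= tau -> rough_isometry tau Phi ->
    0 < eps ->
    uniformization_is_uniform (Phi y0) eps lambda ->
    uniformization_is_uniform y0 eps (Lambda lambda eps tau).
Proof.
(* The first summand alone serves nearby pairs. For the other pairs it bounds the piece containing
   the point, and the second summand bounds the remaining pieces. *)
exists (fun lambda eps tau => near_cst eps tau +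
  chain_cst eps tau * lambda * (transfer_cst eps tau + shadow_cst eps tau)).
move=> X Y tau Phi y0 eps lambda [cX _ _ geoX _] [cY _ _ geoY _] tau0 rPhi eps0.
move=> [dX [_ ncX l1 hX]].
pose dY := d_eps_is_distance y0 eps eps0 geoY; exists dY.
have ncY : ~ complete_space (metric_of dY).
  exact: (rough_isometry_not_complete y0 eps tau eps0 geoX geoY cX Phi tau0 rPhi dX).
have expr1 (r : R) : 0 <= r -> 1 <= expR r by move=> r0; rewrite -expR0 ler_expR.
have K1 : 1 <= step_bound tau by rewrite lerDl mulr_ge0.
have K0 : 0 <= step_bound tau by exact: le_trans K1.
have nc1 : 1 <= near_cst eps tau.
  by rewrite !mulr_ege1// expr1// ?mulr_ge0// ltW.
have rest0 : 0 <= chain_cst eps tau * lambda * (transfer_cst eps tau + shadow_cst eps tau).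
  have l0 : 0 <= lambda by exact: le_trans l1.
  by rewrite !(mulr_ge0, addr_ge0, expR_ge0).
set Lambda := near_cst eps tau + _; have L1 : 1 <= Lambda by rewrite ler_wpDr.
split=> //; first exact: metric_of_locally_complete.
move=> y y'.
have [h [c [d [rp len hb]]]] : exists (h : R -> metric_of dY) (c d : R),
    uniform_path Lambda h c d y y'.
  have [near|far] := leP (mdist (y : Y) y') (step_bound tau).
    have [h [c [d hu]]] :=
      uniform_path_near y0 eps tau eps0 geoY cY tau0 dY ncY y y' near.
    by exists h, c, d; apply: uniform_path_le hu; rewrite lerDl.
  have [g [a [b [rp len hb]]]] := hX (Phi y) (Phi y').
  apply: (uniform_path_far y0 eps tau eps0 geoX geoY cY Phi tau0 rPhi dX dY ncY
    y y' lambda g a b l1).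
    by have := tau0; move: far; rewrite /step_bound; lra.
  split=> // t /hb; rewrite lee_pdivrMl//; exact: lt_le_trans l1.
exists h, c, d; split => // t /hb; rewrite lee_pdivrMl//; exact: lt_le_trans L1.
Qed.
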